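(* Assume the no-overload condition $\mathcal{S}(\bar\Omega)=1$. Then for every $x\in\mathbb{R}$, $$\mathbb{E}\big(\mathfrak{S}(1,\omega,x)\big)=1,$$ where $\mathfrak{S}(1,\omega,x)$ is the number of indices $i\in\mathbb{Z}$ such that $y_i(\omega)<x$ and $y_i(\theta_1\omega)>x$.
   Context: Single-server FIFO queue. Arrivals form a Poisson point process $\mathcal{P}_\lambda$ on $\mathbb{R}$ with continuous positive rate $\lambda$ satisfying $\int_{-\infty}^0\lambda=\int_0^\infty\lambda=\infty$, viewed as a sequence $\ldots<z_{-1}<z_0<z_1<\ldots$ with $z_0$ the smallest positive point. Service times $\mathcal{T}=(\eta_i)_{i\in\mathbb{Z}}$, $\eta_i>0$, form a stationary ergodic process independent of $\mathcal{P}_\lambda$; $\mathcal{S}=\mathcal{P}_\lambda\times\mathcal{T}$ on $\Omega=\{\omega=(\ldots,(z_i,\eta_i),\ldots)\}$, and $\mathbb{E}$ is expectation with respect to $\mathcal{S}$. Nonlinear shift: $\theta_t(x)$ is the unique value with $\int_x^{\theta_t(x)}\lambda(y)\,dy=t$; $\theta_t\omega=(\ldots,(\theta_t(z_i),\eta_i),\ldots)$ (indices kept). $\mathcal{S}$ is invariant under every $\theta_t$. Conflict resolution: let $I(\omega)$ be the set of indices $i$ with $z_i\ge z_{i-k}+\eta_{i-k}$ for all $k>0$. If $I(\omega)=\{\ldots<i_{-1}<i_0<i_1<\ldots\}$ is doubly infinite, define $R\omega$ by $Rz_j=z_j$ for $j\in I(\omega)$ and $Rz_j=z_{i_k}+\eta_{i_k}+\cdots+\eta_{j-1}$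 for $i_k<j<i_{k+1}$. If all $R^n\omega$ are defined and each $R^nz_j$ is eventually constant with limit $\bar Rz_j$, the exit times are $y_j(\omega)=\bar Rz_j+\eta_j$. Let $\tilde\Omega$ be the set of $\omega$ violating only finitely many of the conditions $\sum_{i=-k}^{-1}\eta_i+z_{-k}<0$, $k\ge1$ (on $\tilde\Omega$, $\bar R$ is defined), and $\bar\Omega=\bigcap_{t\in\mathbb{R}}\theta_t\tilde\Omega$. *)

(* Defs.v *)
From HB Require Import structures.
From mathcomp Require Import all_boot all_order all_algebra.
From mathcomp Require Import all_classical all_reals all_analysis.
Set Implicit Arguments. Unset Strict Implicit. Unset Printing Implicit Defensive.
Import Order.TTheory GRing.Theory Num.Theory.
Import numFieldNormedType.Exports.
Local Open Scope classical_set_scope.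
Local Open Scope ring_scope.

Section Queue.
Context {R : realType}.

(* A configuration omega = ((z_i)_i, (eta_i)_i): arrival points and service times. *)
Definition Omega := ((int -> R) * (int -> R))%type.

Definition oint (lam : R -> R) (a b : R) : R :=
  if a <= b then Rintegral lebesgue_measure `[a, b] lam
  else - Rintegral lebesgue_measure `[b, a] lam.

(* theta_t(x): the (unique, under the standing hypotheses on lam) value
   y with int_x^y lam = t *)
Definition theta (lam : R -> R) (t x : R) : R :=
  xget x [set y | oint lam x y = t].

Definition thetaO (lam : R -> R) (t : R) (w : Omega) : Omega :=
  (fun i => theta lam t (w.1 i), w.2).

Definition Iset (z eta : int -> R) : set int :=
  [set i | forall k : int, 0 < k -> z (i - k) + eta (i - k) <= z i].

Definition doubly_infinite (I : set int) : Prop :=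
  forall n : int, (exists i, I i /\ n < i) /\ (exists i, I i /\ i < n).

Definition prevI (z eta : int -> R) (j : int) : int :=
  xget 0 [set i | Iset z eta i /\ i < j /\
                  forall i', Iset z eta i' -> i' < j -> i' <= i].

Definition Rstep (z eta : int -> R) : int -> R := fun j =>
  if `[< Iset z eta j >] then z j
  else let i := prevI z eta j in
       z i + \sum_(0 <= m < `|j - i|%N) eta (i + m%:Z).

Definition iterR (eta : int -> R) (n : nat) (z : int -> R) : int -> R :=
  iter n (fun z' => Rstep z' eta) z.

(* all R^n omega are defined and each R^n z_j is eventually constant *)
Definition Rbar_defined (z eta : int -> R) : Prop :=
  (forall n, doubly_infinite (Iset (iterR eta n z) eta)) /\
  (forall j, exists N, forall n, (N <= n)%N -> iterR eta n z j = iterR eta N z j).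

Definition Rbar (z eta : int -> R) (j : int) : R :=
  xget 0 [set v | exists N, forall n, (N <= n)%N -> iterR eta n z j = v].

Definition exit_time (w : Omega) (j : int) : R := Rbar w.1 w.2 j + w.2 j.

Definition Omega_tilde : set Omega :=
  [set w | exists K : nat, forall k : nat, (K <= k)%N -> (0 < k)%N ->
     \sum_(1 <= i < k.+1) w.2 (- (i%:Z)) + w.1 (- (k%:Z)) < 0].

Definition Omega_bar (lam : R -> R) : set Omega :=
  \bigcap_(t in [set: R]) (thetaO lam t @` Omega_tilde).

Definition Sfrak_set (lam : R -> R) (w : Omega) (x : R) : set int :=
  [set i : int | exit_time w i < x /\ x < exit_time (thetaO lam 1 w) i].

Definition Sfrak (lam : R -> R) (w : Omega) (x : R) : \bar R :=
  (\esum_(i in Sfrak_set lam w x) (1 : \bar R))%E.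

Section Prob.
Context {d : measure_display} {T : measurableType d} (P : probability T R).

Definition count_event (Z : int -> T -> R) (a b : R) (k : nat) : set T :=
  [set w | card_eq [set i : int | a < Z i w <= b] `I_k].

(* (Z_i)_{i in Z} is the increasing enumeration of a Poisson point process
   with rate lam, labelled so that Z_0 is the smallest positive point:
   counts on consecutive disjoint intervals (t_0,t_1],...,(t_{n-1},t_n]
   are independent Poisson with means int_{t_j}^{t_{j+1}} lam. *)
Definition poisson_process (lam : R -> R) (Z : int -> T -> R) : Prop :=
  (forall i, measurable_fun setT (Z i)) /\
  (forall w i, Z i w < Z (i + 1) w) /\
  (forall w, Z (-1) w <= 0 < Z 0 w) /\
  (forall (n : nat) (t : nat -> R) (k : nat -> nat),
     (forall j, (j < n)%N -> t j < t j.+1) ->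
     P (\bigcap_(j in [set j | (j < n)%N]) count_event Z (t j) (t j.+1) (k j))
     = (\prod_(j < n) poisson_pmf (oint lam (t j) (t j.+1)) (k j))%:E).

Definition seq_sigma : set (set (int -> R)) :=
  <<s [set A | exists (i : int) (B : set R), measurable B /\ A = [set s | B (s i)]] >>.

Definition seq_shift (s : int -> R) : int -> R := fun i => s (i + 1).

Definition path_of (X : int -> T -> R) (w : T) : int -> R := fun i => X i w.

Definition stationary (X : int -> T -> R) : Prop :=
  (forall i, measurable_fun setT (X i)) /\
  forall A, seq_sigma A ->
    P (path_of X @^-1` A) = P ((seq_shift \o path_of X) @^-1` A).

Definition ergodic (X : int -> T -> R) : Prop :=
  forall A, seq_sigma A -> seq_shift @^-1` A = A ->
    P (path_of X @^-1` A) = 0%E \/ P (path_of X @^-1` A) = 1%E.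

Definition proc_sigma (X : int -> T -> R) : set (set T) :=
  <<s [set A | exists (i : int) (B : set R), measurable B /\ A = X i @^-1` B] >>.

Definition indep_processes (X Y : int -> T -> R) : Prop :=
  forall A B, proc_sigma X A -> proc_sigma Y B -> P (A `&` B) = (P A * P B)%E.

End Prob.

Definition omega_of {T : Type} (Z H : int -> T -> R) (w : T) : Omega :=
  (fun i => Z i w, fun i => H i w).

End Queue.

(* Main.v *)
Require Import Defs.
From HB Require Import structures.
From mathcomp Require Import all_boot all_order all_algebra.
From mathcomp Require Import all_classical all_reals all_analysis.
From mathcomp Require Import measurable_realfun zify lra ring.
Import Order.TTheory GRing.Theory Num.Theory.
Import numFieldNormedType.Exports.
Local Open Scope classical_set_scope.
Local Open Scope ring_scope.

Set Implicit Arguments.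
Unset Strict Implicit.
Unset Printing Implicit Defensive.

(** Write [E] for the antidifference of the service times.  When the sequence
    [z_i - E_i] tends to [-oo] as [i -> -oo], conflict resolution yields the
    work-conserving exit times [y_j = E_(j+1) + max_(i <= j) (z_i - E_i)].

    This happens almost surely: the event that infinitely many past customers
    keep the server busy beyond [x] (up to a constant) does not depend on the
    labelling of the customers, so its probability does not change under
    [theta_t]; but under no overload, and since the past service times have an
    infinite sum, almost every configuration leaves this event as [t -> oo].

    Let [A_t] and [D_t] be the ranks at [x] of the arrivals and of the exits for
    the configuration shifted by [theta_t].  The queue [A_t - D_t] has a law
    independent of [t] and [A_0 - A_t] is Poisson of mean [t].  As the queue need
    not be integrable, truncate it: that [D_0 - D_t] has mean [t] follows by
    Fatou and dominated convergence, since the truncated differences lie between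
    [A_0 - A_t] and [D_0 - D_t].

    Finally [D_0 - D_1] counts the required indices except for exits exactly at
    [x].  An exit at [x] for the configuration shifted by [theta_t] forces
    [D_0 - D_t >= 1]; its probability does not depend on [t] and is at most [t]
    for every [t > 0], so it vanishes. *)

(** * Conflict resolution and work-conserving exit times *)

Lemma int_ind_up (Q : int -> Prop) (i0 : int) :
  Q i0 -> (forall j, i0 <= j -> Q j -> Q (j + 1)) -> forall j, i0 <= j -> Q j.
Proof.
move=> Q0 QS j ij.
have -> : j = i0 + `|j - i0|%N%:Z by lia.
elim: `|j - i0|%N => [|n IH]; first by rewrite addr0.
have -> : i0 + n.+1%:Z = (i0 + n%:Z) + 1 by lia.
by apply: QS => //; lia.
Qed.

Lemma int_ind_both (Q : int -> Prop) :
  Q 0 -> (forall j, Q j -> Q (j + 1)) -> (forall j, Q (j + 1) -> Q j) ->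
  forall j, Q j.
Proof.
move=> Q0 QS QP [n|n].
  by elim: n => // n IH; have := QS _ IH; rewrite -PoszD addn1.
have -> : Negz n = - n.+1%:Z by [].
elim: n.+1 => [//|{}n IH]; apply: QP.
by have -> : - n.+1%:Z + 1 = - n%:Z by lia.
Qed.

Lemma int_max_exists (Q : int -> Prop) (b : int) :
  (exists i, Q i) -> (forall i, Q i -> i <= b) ->
  exists i, Q i /\ forall i', Q i' -> i' <= i.
Proof.
move=> [i0 Qi0] Qb.
have ex : exists m : nat, `[< Q (b - m%:Z) >].
  exists `|b - i0|%N; apply/asboolP; have := Qb _ Qi0 => ?.
  by have -> : b - `|b - i0|%N%:Z = i0 by lia.
exists (b - (ex_minn ex)%:Z); case: ex_minnP => m /asboolP Qm mmin.
split => // i' Qi'; have ib := Qb _ Qi'.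
have /mmin : `[< Q (b - `|b - i'|%N%:Z) >].
  by apply/asboolP; have -> : b - `|b - i'|%N%:Z = i' by lia.
by lia.
Qed.

Section WorkConservation.
Context {R : realType}.
Implicit Types (z eta b : int -> R) (w : @Omega R).

(** The branch [Negz n] stands for the label -(n+1), whence the bound [n.+2]. The value at 0 is 0,
    and the difference of two values is the total service over the range of labels between them. *)
Definition cumE eta (j : int) : R :=
  match j with
  | Posz n => \sum_(0 <= m < n) eta m%:Z
  | Negz n => - \sum_(1 <= m < n.+2) eta (- m%:Z)
  end.

Lemma cumE0 eta : cumE eta 0 = 0.
Proof. exact: big_geq. Qed.

Lemma cumEN eta (k : nat) : cumE eta (- k%:Z) = - \sum_(1 <= m < k.+1) eta (- m%:Z).
Proof. by case: k => [|k] //; rewrite oppr0 cumE0 big_geq // oppr0. Qed.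

Lemma cumES eta j : cumE eta (j + 1) = cumE eta j + eta j.
Proof.
case: j => [n|n].
  have -> : n%:Z + 1 = n.+1 by lia.
  by rewrite /= big_nat_recr.
have -> : Negz n + 1 = - n%:Z by lia.
have -> : Negz n = - n.+1%:Z by lia.
by rewrite !cumEN (big_nat_recr n.+1) //= opprD addrNK.
Qed.

Lemma cumE_sum eta i j : i <= j ->
  \sum_(0 <= m < `|j - i|%N) eta (i + m%:Z) = cumE eta j - cumE eta i.
Proof.
move: j; apply: int_ind_up; first by rewrite subrr absz0 big_geq // subrr.
move=> j ij; have -> : (`|(j + 1 - i)%R|%N = `|(j - i)%R|%N.+1) by lia.
rewrite big_nat_recr //= cumES => ->.
have -> : i + `|j - i|%N = j by lia.
by ring.
Qed.

Definition gap z eta i : R := z i - cumE eta i.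

(** Equivalently, z_m + eta_m + ... + eta_(i-1) <= z_i for all m < i: no chain of uninterrupted
    services begun in the past lasts beyond the arrival of [i], who is served at once. *)
Definition regen z eta i := forall m, m < i -> gap z eta m <= gap z eta i.

Definition left_regen z eta := forall n : int, exists2 i, i <= n & regen z eta i.

(* [v] is the time at which customer [j] starts its service, if the queue is
   work conserving: the maximum over [i <= j] of [z_i + eta_i + ... + eta_(j-1)]. *)
Definition is_start z eta j v :=
  (forall i, i <= j -> gap z eta i + cumE eta j <= v) /\
  (exists2 i, i <= j & gap z eta i + cumE eta j = v).

Lemma is_start_uniq z eta j v v' : is_start z eta j v -> is_start z eta j v' -> v = v'.
Proof.
move=> [h1 [i ij e]] [h2 [i' ij' e']]; apply: le_anti.
by rewrite -{1}e -{2}e' h1 // h2.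
Qed.

Lemma regen_start z eta i : regen z eta i -> is_start z eta i (z i).
Proof.
move=> ri; split; last by exists i => //; rewrite /gap subrK.
move=> m; rewrite le_eqVlt => /predU1P[->|/ri]; first by rewrite /gap subrK.
by rewrite {2}/gap lerBrDr.
Qed.

(** Lindley's recursion: a chain ending at [j + 1] either begins there or prolongs a chain ending at
    [j] by one service. *)
Lemma is_startS z eta j v : is_start z eta j v ->
  is_start z eta (j + 1) (Num.max (z (j + 1)) (v + eta j)).
Proof.
move=> [h [i ij e]]; split.
  move=> m; rewrite le_eqVlt => /predU1P[->|mj].
    by rewrite /gap subrK le_max lexx.
  rewrite le_max; apply/orP; right; rewrite cumES addrA lerD2r.
  by apply: h; lia.
case: leP => _.
  by exists i; [lia|rewrite cumES addrA e].
by exists (j + 1) => //; rewrite /gap subrK.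
Qed.

(** At a regeneration the maximum is the arrival time itself; the recursion then carries its
    existence to all labels on the right. *)
Lemma start_exists z eta : left_regen z eta -> exists W, forall j, is_start z eta j (W j).
Proof.
move=> lr; suff /choice[W hW] : forall j, exists v, is_start z eta j v by exists W.
move=> j.
have [i ij ri] := lr j; move: j ij; apply: int_ind_up.
  by exists (z i); apply: regen_start.
by move=> j _ [v hv]; eexists; apply: is_startS hv.
Qed.

Lemma is_start_step z eta W : (forall j, is_start z eta j (W j)) ->
  forall j, W (j + 1) = Num.max (z (j + 1)) (W j + eta j).
Proof. by move=> hW j; apply: is_start_uniq (hW _) (is_startS (hW j)). Qed.

(** Barriers that conflict resolution cannot cross; the work-conserving start times form one. *)
Definition supersol z eta b := (forall j, z j <= b j) /\ (forall j, b j + eta j <= b (j + 1)).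

Lemma supersol_mono z eta b : supersol z eta b ->
  forall i j, i <= j -> b i + (cumE eta j - cumE eta i) <= b j.
Proof.
move=> [_ bS] i; apply: int_ind_up; first by rewrite subrr addr0.
by move=> j ij ih; have := bS j; rewrite cumES; lra.
Qed.

Lemma start_supersol z eta W : (forall j, is_start z eta j (W j)) -> supersol z eta W.
Proof.
move=> hW; split => j; last by rewrite (is_start_step hW) le_max lexx orbT.
by have [/(_ j (lexx _))] := hW j; rewrite /gap subrK.
Qed.

Lemma prevI_spec y eta j : (exists2 i, i < j & Iset y eta i) ->
  [/\ Iset y eta (prevI y eta j), prevI y eta j < j &
      forall i, Iset y eta i -> i < j -> i <= prevI y eta j].
Proof.
move=> [i0 i0j Ii0].
have [||i [[Ii ij] imax]] := @int_max_exists (fun i => Iset y eta i /\ i < j) j.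
- by exists i0.
- by move=> i [_ /ltW].
rewrite /prevI; case: xgetP => [i' -> [Ii' [i'j i'max]]|/(_ i)[]] //.
by split => //; split => // ? ? ?; apply: imax.
Qed.

Definition left_unbounded (I : set int) := forall n : int, exists2 i, i < n & I i.

Lemma RstepI y eta j : Iset y eta j -> Rstep y eta j = y j.
Proof. by move=> Ij; rewrite /Rstep asboolT. Qed.

Lemma RstepNI y eta j : left_unbounded (Iset y eta) -> ~ Iset y eta j ->
  Rstep y eta j = y (prevI y eta j) + (cumE eta j - cumE eta (prevI y eta j)).
Proof.
move=> lu nIj; rewrite /Rstep asboolF //= cumE_sum //.
by have [_ /ltW] := prevI_spec (lu j).
Qed.

(** Both [j] and [j + 1] are placed from the same last conflict-free index, possibly [j] itself, so
    exactly one service separates them. *)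
Lemma RstepNI_pred y eta j : left_unbounded (Iset y eta) -> ~ Iset y eta (j + 1) ->
  Rstep y eta (j + 1) = Rstep y eta j + eta j.
Proof.
move=> lu nIj; rewrite (RstepNI lu nIj).
have [Ip pj pmax] := prevI_spec (lu (j + 1)).
have [Ij|nIj'] := pselect (Iset y eta j).
  have -> : prevI y eta (j + 1) = j by have := pmax _ Ij; lia.
  by rewrite (RstepI Ij) cumES; ring.
rewrite (RstepNI lu nIj') cumES.
have [Ip' pj' pmax'] := prevI_spec (lu j).
have -> : prevI y eta (j + 1) = prevI y eta j; last by ring.
apply/le_anti/andP; split; last by apply: pmax => //; lia.
apply: pmax' => //.
suff : prevI y eta (j + 1) <> j by lia.
by move=> e; rewrite e in Ip.
Qed.

Section Positive.
Variable eta : int -> R.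
Hypothesis eta_gt0 : forall i, 0 < eta i.

Lemma cumE_lt : {homo cumE eta : i j / i < j}.
Proof.
move=> i j ij; have {ij} : i + 1 <= j by lia.
move: j; apply: int_ind_up; first by rewrite cumES ltrDl.
by move=> j _ h; rewrite cumES (lt_trans h) // ltrDl.
Qed.

Lemma cumE_le i j : i <= j -> cumE eta i <= cumE eta j.
Proof. by rewrite le_eqVlt => /predU1P[->//|/cumE_lt/ltW]. Qed.

(** On the block that follows a conflict-free [i], [Rstep] stacks services after [y i]. If [m] in
    the block is in conflict with [m - k], then [y m] is less than the end of service of [m - k].
    That end is at most [y i] when [m - k < i]; otherwise strong induction bounds [y (m - k)] by its
    stacked time, and the stack contains the service of [m - k] before [m]. *)
Lemma Rstep_ge y j : left_unbounded (Iset y eta) -> y j <= Rstep y eta j.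
Proof.
move=> lu; have [Ij|nIj] := pselect (Iset y eta j); first by rewrite RstepI.
have [Ii ij imax] := prevI_spec (lu j).
move: Ii ij imax; set i := prevI y eta j => Ii ij imax.
have nI m : i < m -> m <= j -> ~ Iset y eta m.
  by rewrite [m <= j]le_eqVlt => im /predU1P[->//|mj] /imax/(_ mj); lia.
have Ri m : i <= m -> m <= j -> Rstep y eta m = y i + (cumE eta m - cumE eta i).
  move: m; apply: int_ind_up; first by rewrite RstepI // subrr addr0.
  move=> m im ih mj; rewrite RstepNI_pred ?ih ?cumES; [ring|lia|by []|].
  by apply: nI; lia.
have key (n : nat) : forall m, i <= m -> m <= j -> (`|m - i|%N <= n)%N -> y m <= Rstep y eta m.
  elim: n => [|n ih] m im mj mn.
    by rewrite (_ : m = i); [rewrite RstepI|lia].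
  have [->|mi] := eqVneq m i; first by rewrite RstepI.
  have : ~ Iset y eta m by apply: nI => //; lia.
  move=> /existsNP[k /not_implyP[k0 /negP]]; rewrite -ltNge => ym.
  apply: (le_trans (ltW ym)); rewrite (Ri m) //.
  have [mki|imk] := ltP (m - k) i.
    apply: (@le_trans _ _ (y i)).
      have := Ii (i - (m - k)); rewrite (_ : i - (i - (m - k)) = m - k); last by lia.
      by apply; lia.
    by rewrite lerDl subr_ge0 cumE_le.
  have := ih (m - k) imk; rewrite Ri //; last by lia.
  have := @cumE_le (m - k + 1) m; rewrite cumES => h1 h2.
  have {}h1 := h1 ltac:(lia).
  have {}h2 := h2 ltac:(lia) ltac:(lia).
  lra.
by apply: (key `|j - i|%N) => //; lia.
Qed.

Lemma Rstep_le y b j : left_unbounded (Iset y eta) -> supersol y eta b ->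
  Rstep y eta j <= b j.
Proof.
move=> lu sb; have [Ij|nIj] := pselect (Iset y eta j).
  by rewrite RstepI //; apply: sb.1.
rewrite RstepNI //; have [_ ij _] := prevI_spec (lu j).
by apply: le_trans (supersol_mono sb (ltW ij)); rewrite lerD2r; apply: sb.1.
Qed.

(** The value [y i] is squeezed between [z i] and [b i]. The barrier leaves room for each service,
    so an earlier customer is done by [b (i - k + 1)], hence by [b i]. *)
Lemma regen_Iset y z b i : (forall j, z j <= y j) -> supersol y eta b ->
  b i = z i -> Iset y eta i /\ y i = z i.
Proof.
move=> zy sb bz; have yi : y i = z i.
  by apply/le_anti; rewrite zy andbT -bz; apply: sb.1.
split=> // k k0; rewrite yi -bz.
apply: le_trans (supersol_mono sb (_ : i - k + 1 <= i)); last by lia.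
have := sb.2 (i - k); have := sb.1 (i - k).
have := @cumE_le (i - k + 1) i ltac:(lia); lra.
Qed.

Section Iterates.
Variables (z W : int -> R).
Hypotheses (lr : left_regen z eta) (hW : forall j, is_start z eta j (W j)).

Let W_regen i : regen z eta i -> W i = z i.
Proof. by move=> /regen_start; apply: is_start_uniq. Qed.

Lemma supersol_left_unbounded y : (forall j, z j <= y j) -> supersol y eta W ->
  left_unbounded (Iset y eta).
Proof.
move=> zy sy n; have [i iN ri] := lr (n - 1).
exists i; first by lia.
by have [] := regen_Iset zy sy (W_regen ri).
Qed.

Lemma iterR_bounds n : (forall j, z j <= iterR eta n z j) /\ supersol (iterR eta n z) eta W.
Proof.
elim: n => [|n [ge sW]]; first by split=> //; exact: start_supersol.
have lu := supersol_left_unbounded ge sW.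
split=> [j|]; first exact/(le_trans (ge j))/Rstep_ge.
by split=> [j|]; [exact: Rstep_le|exact: sW.2].
Qed.

(** Induction to the right from a regeneration, where all iterates agree with [z]. *)
Lemma iterR_eventually j : exists N, forall n, (N <= n)%N -> iterR eta n z j = W j.
Proof.
have [i ij ri] := lr j; move: j ij; apply: int_ind_up.
  exists 0%N => n _; have [ge sW] := iterR_bounds n.
  by rewrite (regen_Iset ge sW (W_regen ri)).2 W_regen.
(* One more iteration settles [j + 1]: if it is conflict-free, it already lies beyond the settled
   end of service of [j]; if not, it is moved exactly there. The upper bound is the barrier [W]. *)
move=> j ij [N hN]; exists N.+1 => -[//|n] Nn.
have [geS sWS] := iterR_bounds n.+1.
have [ge sW] := iterR_bounds n.
apply/le_anti; rewrite sWS.1 andTb.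
rewrite (is_start_step hW) ge_max geS andTb.
have lu := supersol_left_unbounded ge sW.
have [Ij|nIj] := pselect (Iset (iterR eta n z) eta (j + 1)).
  rewrite /= [Rstep _ _ _]RstepI //.
  have := Ij 1 ltac:(lia); rewrite addrK -/(iterR _ _ _) hN //.
have -> : iterR eta n.+1 z (j + 1) = iterR eta n.+1 z j + eta j.
  exact: RstepNI_pred.
by rewrite hN //; exact: ltnW.
Qed.

Lemma Rbar_start j : Rbar z eta j = W j.
Proof.
rewrite /Rbar; have [N hN] := iterR_eventually j.
case: xgetP => [v -> [N' hN']|/(_ (W j)) []]; last by exists N.
by rewrite -(hN' (maxn N N')) ?leq_maxr // hN // leq_maxl.
Qed.

End Iterates.
End Positive.

Lemma exit_time_spec w : (forall i, 0 < w.2 i) -> left_regen w.1 w.2 ->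
  forall j, (forall i, i <= j -> gap w.1 w.2 i + cumE w.2 (j + 1) <= exit_time w j) /\
            (exists2 i, i <= j & gap w.1 w.2 i + cumE w.2 (j + 1) = exit_time w j).
Proof.
move=> eta0 lr j; have [W hW] := start_exists lr.
rewrite /exit_time (Rbar_start eta0 lr hW).
have [h [i ij e]] := hW j.
split; last by exists i => //; rewrite cumES addrA e.
by move=> m mj; rewrite cumES addrA lerD2r h.
Qed.

End WorkConservation.

(** * The nonlinear shift *)

Section NonlinearShift.
Context {R : realType}.
Variable lam : R -> R.
Hypotheses (clam : continuous lam) (lam_gt0 : forall y, 0 < lam y).
Hypothesis lam_left :
  (\int[lebesgue_measure]_(u in `]-oo, 0%R]) (lam u)%:E = +oo)%E.
Hypothesis lam_right :
  (\int[lebesgue_measure]_(u in `[0%R, +oo[) (lam u)%:E = +oo)%E.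
Local Notation mu := (@lebesgue_measure R).

Let lam_int a b : mu.-integrable `[a, b] (EFin \o lam).
Proof.
apply: continuous_compact_integrable; first exact: segment_compact.
by apply: continuous_subspaceT => x; exact: clam.
Qed.

Let lam_meas : measurable_fun setT lam.
Proof.
apply: subspace_continuous_measurable_fun => //.
by apply: continuous_subspaceT => x; exact: clam.
Qed.

Let I a b := Rintegral mu `[a, b] lam.

Let I_split a b c : a <= b -> b <= c -> I a c = I a b + I b c.
Proof.
move=> ab bc; rewrite /I.
have := @Rintegral_itvB R lam (BLeft a) (BRight c) b (lam_int a c).
rewrite !bnd_simp => /(_ ab bc) /eqP; rewrite subr_eq => /eqP ->.
rewrite addrC; congr (_ + _); apply: Rintegral_itv_obnd_cbnd.
apply: integrableS (lam_int b c) => //.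
by move=> x /=; rewrite !in_itv /= => /andP[/ltW -> ->].
Qed.

Let I_gt0 a b : a < b -> 0 < I a b.
Proof.
move=> ab; have [c cab cmin] := EVT_min (ltW ab) (continuous_subspaceT clam).
have icst : mu.-integrable `[a, b] (EFin \o cst (lam c)).
  apply: continuous_compact_integrable; first exact: segment_compact.
  by apply: continuous_subspaceT => x; exact: cvg_cst.
have : 0 <= Rintegral mu `[a, b] (lam \- cst (lam c)).
  by apply: Rintegral_ge0 => x /cmin; rewrite subr_ge0.
rewrite RintegralB // subr_ge0; apply: lt_le_trans.
rewrite Rintegral_cst // mulr_gt0 //= lebesgue_measure_itv /= lte_fin ab.
by rewrite -EFinD /= subr_gt0.
Qed.

Lemma oint_trans a b c : oint lam a b + oint lam b c = oint lam a c.
Proof.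
have I0 x : I x x = 0 by rewrite /I set_itv1 Rintegral_set1.
have oN x y : oint lam x y = - oint lam y x.
  rewrite /oint; case: ltgtP => [||->]; rewrite ?opprK //.
  by have := I0 y; rewrite /I => ->; rewrite oppr0.
have ole x y z : x <= y -> y <= z -> oint lam x y + oint lam y z = oint lam x z.
  by move=> xy yz; rewrite /oint xy yz (le_trans xy yz) -I_split.
have [ab|/ltW ab] := leP a b; have [bc|/ltW bc] := leP b c.
- exact: ole.
- have [ac|/ltW ac] := leP a c.
    by rewrite -(ole a c b) // (oN c b) addrNK.
  by rewrite (oN b c) -(ole c a b) // (oN c a); ring.
- have [ac|/ltW ac] := leP a c.
    by rewrite -(ole b a c) // (oN a b) addrA addNr add0r.
  by rewrite (oN a b) -(ole b c a) // (oN a c); ring.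
- by rewrite (oN a b) (oN b c) (oN a c) -(ole c b a) //; ring.
Qed.

Lemma oint_gt0 a b : a < b -> 0 < oint lam a b.
Proof. by move=> ab; rewrite /oint ltW // I_gt0. Qed.

Local Notation Lam := (oint lam 0).

Lemma ointE a b : oint lam a b = Lam b - Lam a.
Proof. by rewrite -(oint_trans 0 a b) addrAC subrr add0r. Qed.

Lemma Lam_lt : {mono Lam : x y / x < y}.
Proof.
apply: leW_mono; apply: le_mono => x y /oint_gt0.
by rewrite ointE subr_gt0.
Qed.

Let Lam_IVT a b v : a <= b -> Lam a <= v -> v <= Lam b -> exists x, Lam x = v.
Proof.
move=> ab av vb.
(* The available continuous primitive starts at [a] instead of 0, so the intermediate value sought
   is [v - Lam a]. *)
have cI := parameterized_integral_continuous ab (lam_int a b).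
have E x : a <= x -> parameterized_integral mu a x lam = Lam x - Lam a.
  by move=> ax; rewrite -ointE /oint ax.
have [|c cab] := IVT (v := v - Lam a) ab cI.
  rewrite !E // subrr min_l ?max_r ?subr_ge0 ?lerD2r; first by rewrite av vb.
  - by rewrite (le_trans av).
  - by rewrite (le_trans av).
rewrite E; last by move: cab; rewrite in_itv => /andP[].
by move=> /addIr <-; exists c.
Qed.

(** Otherwise monotone convergence along the segments from 0 to n would bound the infinite integral
    of [lam] by [v]. *)
Let Lam_right v : exists n : nat, v <= Lam n%:R.
Proof.
apply: contrapT => h.
have hn n : Lam n%:R < v by rewrite ltNge; apply/negP => ?; apply: h; exists n.
have : (\int[mu]_(u in `[0%R, n%:R]) (lam u)%:E @[n --> \oo] -->
   \int[mu]_(u in \bigcup_n `[0%R, n%:R]%classic) (lam u)%:E)%E.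
  apply: ge0_nondecreasing_set_cvg_integral => //.
  - move=> n m nm; apply/subsetPset => x /=; rewrite !in_itv /= => /andP[-> xn] /=.
    by rewrite (le_trans xn) // ler_nat.
  - by move=> n; apply/measurable_EFinP; exact: measurable_funTS.
  - by move=> n x _; rewrite lee_fin ltW.
have -> : \bigcup_n `[0%R, n%:R]%classic = `[0%R, +oo[%classic :> set R.
  apply/seteqP; split => x /=.
    by move=> [n _] /=; rewrite !in_itv /= andbT => /andP[].
  rewrite in_itv /= andbT => x0; exists (Num.truncn x).+1 => //=.
  by rewrite in_itv /= x0 ltW // truncnS_gt.
rewrite lam_right => /cvg_lim; move=> /(_ (@ereal_hausdorff _)) e.
have : (limn (fun n : nat => \int[mu]_(u in `[0%R, n%:R]) (lam u)%:E) <= v%:E)%E.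
  apply: lime_le.
    apply: ereal_nondecreasing_is_cvgn; apply/nondecreasing_seqP => n.
    apply: ge0_subset_integral => //.
    - by apply/measurable_EFinP; exact: measurable_funTS.
    - by move=> x _; rewrite lee_fin ltW.
    - by move=> x /=; rewrite !in_itv /= => /andP[-> xn] /=; rewrite (le_trans xn) // ler_nat.
  apply: nearW => n; have := hn n; rewrite /oint ler0n /Rintegral => /ltW.
  by rewrite -lee_fin fineK //; apply: integrable_fin_num.
by rewrite e leye_eq.
Qed.

Let Lam_left v : exists n : nat, Lam (- n%:R) <= v.
Proof.
apply: contrapT => h.
have hn n : v < Lam (- n%:R) by rewrite ltNge; apply/negP => ?; apply: h; exists n.
have : (\int[mu]_(u in `[(- n%:R)%R, 0%R]) (lam u)%:E @[n --> \oo] -->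
   \int[mu]_(u in \bigcup_n `[(- n%:R)%R, 0%R]%classic) (lam u)%:E)%E.
  apply: ge0_nondecreasing_set_cvg_integral => //.
  - move=> n m nm; apply/subsetPset => x /=; rewrite !in_itv /= => /andP[xn ->] /=.
    by rewrite andbT (le_trans _ xn) // lerN2 ler_nat.
  - by move=> n; apply/measurable_EFinP; exact: measurable_funTS.
  - by move=> n x _; rewrite lee_fin ltW.
have -> : \bigcup_n `[(- n%:R)%R, 0%R]%classic = `]-oo, 0%R]%classic :> set R.
  apply/seteqP; split => x /=.
    by move=> [n _] /=; rewrite !in_itv /= => /andP[].
  rewrite in_itv /= => x0; exists (Num.truncn (- x)).+1 => //=.
  by rewrite in_itv /= x0 andbT lerNl ltW // truncnS_gt.
rewrite lam_left => /cvg_lim; move=> /(_ (@ereal_hausdorff _)) e.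
have : (limn (fun n : nat => \int[mu]_(u in `[(- n%:R)%R, 0%R]) (lam u)%:E) <= (- v)%:E)%E.
  apply: lime_le.
    apply: ereal_nondecreasing_is_cvgn; apply/nondecreasing_seqP => n.
    apply: ge0_subset_integral => //.
    - by apply/measurable_EFinP; exact: measurable_funTS.
    - by move=> x _; rewrite lee_fin ltW.
    - by move=> x /=; rewrite !in_itv /= => /andP[xn ->] /=; rewrite andbT (le_trans _ xn) // lerN2 ler_nat.
  apply: nearW => n; have := hn n.
  have -> : Lam (- n%:R) = - oint lam (- n%:R) 0.
    by have := ointE 0 0; rewrite [oint _ (- _) _]ointE; lra.
  rewrite ltrNr => /ltW; rewrite /oint oppr_le0 ler0n /Rintegral.
  by rewrite -lee_fin fineK //; apply: integrable_fin_num.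
by rewrite e leye_eq.
Qed.

Lemma Lam_surj v : exists x, Lam x = v.
Proof.
have [m mv] := Lam_left v; have [n vn] := Lam_right v.
by apply: Lam_IVT mv vn; rewrite (@le_trans _ _ 0) // oppr_le0.
Qed.

Lemma Lam_inj : injective Lam.
Proof. by move=> x y e; case: (ltgtP x y) => //; rewrite -Lam_lt e ltxx. Qed.

(** In the coordinate [Lam] the shift is translation by [t]; surjectivity excludes the default value
    of [xget]. The group law and monotonicity of [theta] follow from this. *)
Lemma Lam_theta t x : Lam (theta lam t x) = Lam x + t.
Proof.
rewrite /theta; have [y Ey] := Lam_surj (Lam x + t).
case: xgetP => [z -> /=|/(_ y)]; rewrite /= ointE; last by rewrite Ey addrAC subrr add0r.
by move/eqP; rewrite subr_eq addrC => /eqP.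
Qed.

Lemma theta0 x : theta lam 0 x = x.
Proof. by apply: Lam_inj; rewrite Lam_theta addr0. Qed.

Lemma thetaD s t x : theta lam s (theta lam t x) = theta lam (s + t) x.
Proof. by apply: Lam_inj; rewrite !Lam_theta addrA addrAC. Qed.

Lemma theta_lt t : {mono theta lam t : x y / x < y}.
Proof. by move=> x y; rewrite -Lam_lt !Lam_theta ltrD2r Lam_lt. Qed.

Lemma theta_lt_time s t x : s < t -> theta lam s x < theta lam t x.
Proof. by move=> st; rewrite -Lam_lt !Lam_theta ltrD2l. Qed.

Lemma oint_theta t a b : oint lam (theta lam t a) (theta lam t b) = oint lam a b.
Proof. by rewrite [LHS]ointE [RHS]ointE !Lam_theta; ring. Qed.

End NonlinearShift.

(** * Probability preliminaries *)

Lemma sigma_preimage (T U : Type) (G : set (set U)) (M : set (set T)) (f : T -> U) :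
  sigma_algebra setT M -> (forall A, G A -> M (f @^-1` A)) ->
  forall A, <<s G >> A -> M (f @^-1` A).
Proof.
move=> [M0 MC MU] GM.
apply: (@smallest_sub _ (sigma_algebra setT) G [set A | M (f @^-1` A)]) => //.
split => [|A MA|A MA] /=; first by rewrite preimage_set0.
- by have := MC _ MA; rewrite !setTD preimage_setC.
- by rewrite preimage_bigcup; apply: MU.
Qed.

Section MeasureGeneralities.
Context {d : measure_display} {T : measurableType d} {R : realType}.

Lemma measurable_ex (I : countType) (F : I -> set T) :
  (forall i, measurable (F i)) -> measurable [set w | exists i, F i w].
Proof.
move=> mF; have -> : [set w | exists i, F i w] = \bigcup_i F i.
  by apply/seteqP; split => w [i]; [exists i|move=> _; exists i].
exact: countable_bigcupT_measurable.
Qed.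

Lemma measurable_all (I : countType) (F : I -> set T) :
  (forall i, measurable (F i)) -> measurable [set w | forall i, F i w].
Proof.
move=> mF; rewrite -[X in measurable X]setCK; apply: measurableC.
have -> : ~` [set w | forall i, F i w] = [set w | exists i, (~` F i) w].
  apply/seteqP; split => w /=; first by move=> /existsNP.
  by move=> [i nF] /(_ i).
by apply: measurable_ex => i; apply: measurableC.
Qed.

Lemma measurable_const (Q : Prop) : measurable [set w : T | Q].
Proof.
have [q|q] := pselect Q.
  have -> : [set w : T | Q] = setT by apply/seteqP; split.
  exact: measurableT.
have -> : [set w : T | Q] = set0 by apply/seteqP; split.
exact: measurable0.
Qed.

Variable P : probability T R.

Lemma probI_full (G A : set T) : measurable G -> P G = 1%E -> measurable A -> P (G `&` A) = P A.
Proof.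
move=> mG G1 mA; have mCG : measurable (~` G) by exact: measurableC.
have CG0 : P (~` G) = 0%E by rewrite probability_setC // G1 subee.
have -> : P A = (P (A `\` G) + P (A `&` G))%E by rewrite -measureDI.
rewrite setIC (_ : P (A `\` G) = 0)%E ?add0e //.
apply/eqP; rewrite eq_le measure_ge0 andbT -CG0.
by apply: le_measure; rewrite ?inE; [exact: measurableD | exact: mCG | move=> w []].
Qed.

Lemma prob_full_forall (I : countType) (F : I -> set T) :
  (forall i, measurable (F i)) -> (forall i, P (F i) = 1%E) ->
  P [set w | forall i, F i w] = 1%E.
Proof.
move=> mF F1; set E := [set w | _].
have mE : measurable E by exact: measurable_all.
suff : P (~` E) = 0%E.
  rewrite probability_setC // => /eqP; rewrite sube_eq ?fin_num_measure //.
  by rewrite add0e => /eqP.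
(* Reindexing by natural numbers: codes that name no element of [I] contribute the empty set. *)
pose F' m := if @pickle_inv I m is Some i then ~` F i else set0.
have mF' m : measurable (F' m).
  by rewrite /F'; case: pickle_inv => // i; apply: measurableC.
have EF : ~` E `<=` \bigcup_(m in ~` `I_0) F' m.
  by move=> w /= /existsNP[i nF]; exists (pickle i) => //=; rewrite /F' pickleK_inv.
have := measure_sigma_subadditive_tail P mF' (measurableC mE) EF.
move=> h; apply/eqP; rewrite eq_le measure_ge0 andbT (le_trans h) //.
rewrite eseries0 // => m _ _; rewrite /F'; case: (@pickle_inv I m) => [i|].
  by rewrite /= probability_setC // F1 subee.
exact: measure0.
Qed.

(** Uniqueness of the index makes both unions disjoint, so countable additivity sums the termwise
    identities. In the applications the index is the label of the first point after a given time. *)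
Lemma prob_ex_scale (I : countType) (A B : I -> set T) (c : R) :
  (forall i, measurable (A i)) -> (forall i, measurable (B i)) ->
  (forall i j w, A i w -> A j w -> i = j) -> (forall i j w, B i w -> B j w -> i = j) ->
  (forall i, P (A i) = (c%:E * P (B i))%E) ->
  P [set w | exists i, A i w] = (c%:E * P [set w | exists i, B i w])%E.
Proof.
move=> mA mB tA tB AB.
have key (C : I -> set T) : (forall i, measurable (C i)) ->
    (forall i j w, C i w -> C j w -> i = j) ->
    P [set w | exists i, C i w] =
    (\sum_(0 <= m <oo) P (if @pickle_inv I m is Some i then C i else set0))%E.
  move=> mC tC; rewrite -measure_semi_bigcup.
  - congr (P _); apply/seteqP; split => w /=.
      by move=> [i Ci]; exists (pickle i) => //; rewrite pickleK_inv.
    by move=> [m _]; case: pickle_inv => // i Ci; exists i.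
  - by move=> m; case: pickle_inv.
  - move=> m n _ _ [w []].
    case em: (@pickle_inv I m) => [i|//]; case en: (@pickle_inv I n) => [j|//] Ci Cj.
    have := @pickle_invK I m; have := @pickle_invK I n.
    by rewrite em en /= (tC _ _ _ Ci Cj) => -> ->.
  - by apply: bigcup_measurable => m _; case: pickle_inv.
rewrite !key // -nneseriesZl //; apply: eq_eseriesr => m _.
by case: pickle_inv => [i|]; [exact: AB|rewrite measure0 mule0].
Qed.

(** Dynkin's pi-lambda argument; measurability of both preimages is carried along with the
    equality. *)
Lemma law_eq U (G : set (set U)) (f g : T -> U) : setI_closed G ->
  (forall A, G A -> [/\ measurable (f @^-1` A), measurable (g @^-1` A) &
     P (f @^-1` A) = P (g @^-1` A)]) ->
  forall A, <<s G >> A -> [/\ measurable (f @^-1` A), measurable (g @^-1` A) &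
     P (f @^-1` A) = P (g @^-1` A)].
Proof.
move=> GI GH; apply: (@lambda_system_subset _ G GI setT
  [set A | [/\ measurable (f @^-1` A), measurable (g @^-1` A) &
     P (f @^-1` A) = P (g @^-1` A)]]) => //.
apply/dynkin_lambda_system; split.
- by split; rewrite ?preimage_setT.
- move=> A [mf mg e]; split; rewrite -?preimage_setC; try exact: measurableC.
  by rewrite !probability_setC // e.
- move=> F tF HF; split; rewrite ?preimage_bigcup.
  + by apply: bigcup_measurable => n _; have [] := HF n.
  + by apply: bigcup_measurable => n _; have [] := HF n.
  rewrite !measure_semi_bigcup //; first by apply: eq_eseriesr => n _; have [] := HF n.
  all: try by move=> n; have [] := HF n.
  all: try by apply: bigcup_measurable => n _; have [] := HF n.
  all: apply/trivIsetP => i j _ _ ij; rewrite -preimage_setI.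
all: by have /trivIsetP -> := tF; rewrite ?preimage_set0.
Qed.

End MeasureGeneralities.

Section FullMeasure.
Context {d : measure_display} {T : measurableType d} {R : realType}.
Variable P : probability T R.

(** The events that no [F n] with n >= N occurs increase to an almost sure event, while each of them
    lies in the complement of [F N], of probability 1 - p. Hence 1 <= 1 - p. *)
Lemma null_recurrence (F : nat -> set T) (G : set T) p :
  (forall n, measurable (F n)) -> (forall n, P (F n) = p) ->
  measurable G -> P G = 1%E ->
  (forall w, G w -> exists N, forall n, (N <= n)%N -> ~ F n w) -> p = 0%E.
Proof.
move=> mF Fp mG G1 hG.
pose V N := [set w | forall n, (if (N <= n)%N then ~` F n else setT) w].
have mV N : measurable (V N).
  by apply: measurable_all => n; case: ifPn => // _; exact: measurableC.
have ndV : nondecreasing_seq V.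
  move=> m n mn; apply/subsetPset => w Vm k; case: ifPn => // nk.
  by have := Vm k; rewrite (leq_trans mn nk).
have mUV : measurable (\bigcup_n V n) by exact: bigcupT_measurable.
have PV1 : P (\bigcup_n V n) = 1%E.
  apply/eqP; rewrite eq_le probability_le1 //= -G1.
  apply: le_measure; rewrite ?inE // => w /hG[N hN].
  by exists N => // n; case: ifPn => // /hN.
have cvgV : (P \o V) n @[n --> \oo] --> 1%E.
  by rewrite -PV1; exact: nondecreasing_cvg_mu.
have p1 : (1 <= 1 - p)%E.
  rewrite [leLHS](_ : 1%E = limn (P \o V)); last by apply/esym/cvg_lim.
  apply: lime_le; first by apply/cvg_ex; exists 1%E.
  apply: nearW => N /=; 
  rewrite (_ : 1 - p = P (~` F N))%E; last by rewrite probability_setC // Fp.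
  apply: le_measure; rewrite ?inE //; first exact: measurableC.
  by move=> w /(_ N); rewrite leqnn.
have p0 : (0 <= p)%E by rewrite -(Fp 0%N).
have pfin : p \is a fin_num by rewrite -(Fp 0%N) fin_num_measure.
move: p1 p0; rewrite -(fineK pfin) -EFinB !lee_fin => p1 p0.
by congr (_%:E); lra.
Qed.

Import HBNNSimple.

(* Needed because [Sfrak] is not known to be measurable, unlike the function
   that it equals almost everywhere. *)
Lemma integral_full (f : T -> \bar R) (G : set T) : measurable G -> P G = 1%E ->
  (forall w, 0 <= f w)%E -> (\int[P]_w f w = \int[P]_(w in G) f w)%E.
Proof.
move=> mG G1 f0; rewrite ge0_integralTE // ge0_integralE //.
have CG0 : P (~` G) = 0%E by rewrite probability_setC // G1 subee.
apply/eqP; rewrite eq_le; apply/andP; split; last first.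
  apply: le_ereal_sup => _ [h hf <-]; exists h => // w.
  by apply: (le_trans (hf w)); rewrite /patch; case: ifP.
apply: ge_ereal_sup => _ [h hf <-]; apply: ereal_sup_ubound.
(* A simple function below [f], cut down to [G], lies below the restriction of [f] and keeps its
   integral because the complement of [G] is null. *)
exists (proj_nnsfun h mG) => /=.
  move=> w; rewrite /proj_nnsfun /= mindicE /patch; case: ifPn => wG.
    by rewrite mulr1; exact: hf.
  by rewrite mulr0.
rewrite -[LHS]/(sintegral P (proj_nnsfun h mG)) -mrestrict.
have <- := integral_nnsfun P mG h.
have := integral_nnsfun P measurableT h; rewrite patch_setT => <-.
have mh : measurable_fun setT (EFin \o h) by apply/measurable_EFinP.
rewrite -(setUv G) ge0_integral_setU //.
- rewrite [X in (_ + X)%E]null_set_integral ?adde0 //.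
  + exact: measurableC.
  + exact: measurable_funTS.
- exact: measurableC.
- by rewrite setUv.
- by move=> w _; rewrite lee_fin.
- by apply/disj_setPS => w [].
Qed.

End FullMeasure.

(** * Total mass and mean of the Poisson law *)

Section PoissonMoments.
Context {R : realType}.

Lemma poisson_pmf_sum (r : R) : 0 < r -> (\sum_(0 <= k <oo) (poisson_pmf r k)%:E = 1)%E.
Proof.
move=> r0; have e : poisson_prob r 0 setT = 1%E by exact: probability_setT.
rewrite /poisson_prob r0 in e; rewrite -e.
by rewrite -nneseries_esumT // => k; rewrite lee_fin poisson_pmf_ge0.
Qed.

Lemma poisson_pmf_mean (r : R) : 0 < r ->
  (\sum_(0 <= k <oo) (k%:R * poisson_pmf r k)%:E = r%:E)%E.
Proof.
move=> r0; rewrite nneseries_recl //; last first.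
  by move=> k _; rewrite lee_fin mulr_ge0 // poisson_pmf_ge0.
rewrite mul0r add0e -(nneseries_addn 1); last first.
  by move=> k; rewrite lee_fin mulr_ge0 // poisson_pmf_ge0.
rewrite -[RHS]mule1 -(poisson_pmf_sum r0) -nneseriesZl; last first.
  by move=> k _; rewrite lee_fin poisson_pmf_ge0.
(* After the index shift, the identity is (k+1) p(k+1) = r p(k). *)
apply: eq_eseriesr => k _; rewrite -EFinM; congr (_%:E).
rewrite /poisson_pmf r0 addn1 factS exprS natrM invfM.
have k0 : k.+1%:R != 0 :> R by rewrite pnatr_eq0.
have f0 : k`!%:R != 0 :> R by rewrite pnatr_eq0 -lt0n fact_gt0.
by field; rewrite nat1r k0 f0.
Qed.

Lemma esum_int_range (D1 D0 : int) : D1 <= D0 ->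
  (\esum_(i in [set i : int | (D1 <= i < D0)%R]) (1 : \bar R) = (D0 - D1)%:~R%:E)%E.
Proof.
move=> D10.
rewrite (_ : [set i : int | D1 <= i < D0] = (fun m : nat => D1 + m%:Z) @` `I_(`|D0 - D1|%N)).
  rewrite esum_image; last by move=> x y _ _; lia.
  rewrite esum_fset // -?fsbig_ord ?sumr_const ?card_ord.
    have e : D0 - D1 = `|D0 - D1|%N%:Z by lia.
    by rewrite [in RHS]e -pmulrn; elim: `|_|%N => [//|n ih]; rewrite mulrS (mulrS 1%R) ih.
apply/seteqP; split => i /=.
  by move=> h; exists `|i - D1|%N => /=; lia.
by move=> [m /= mk <-]; lia.
Qed.

End PoissonMoments.

(** * Counting points *)

Lemma infinite_image T (f : nat -> T) : injective f -> infinite_set (f @` setT).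
Proof.
move=> fI; apply/infiniteP.
have : (f @` setT #= [set: nat])%card by apply: inj_card_eq => x y _ _; exact: fI.
by rewrite card_eq_le => /andP[].
Qed.

Section Enumeration.
Local Open Scope card_scope.
Context {R : realType}.
Implicit Types (z : int -> R) (a b c : R).

(** The counting function at [c], as a relation: for increasing [z], [k] is the label of the first
    point after [c]. *)
Definition at_rank c (k : int) z := z (k - 1) <= c /\ c < z k.

Definition two_sided z := (forall c, exists i, c < z i) /\ (forall c, exists i, z i <= c).

Section Increasing.
Variable z : int -> R.
Hypothesis z_step : forall i, z i < z (i + 1).

Lemma z_lt : {mono z : i j / i < j}.
Proof.
apply: leW_mono; apply: le_mono => i j ij.
have {ij} : i + 1 <= j by lia.
move: j; apply: int_ind_up => // j _ /lt_trans; exact.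
Qed.

Lemma z_le : {mono z : i j / i <= j}.
Proof. by move=> i j; rewrite !leNgt z_lt. Qed.

Lemma at_rank_le c k i : at_rank c k z -> (z i <= c) = (i < k).
Proof.
move=> [h1 h2]; apply/idP/idP => [h|ik].
  by rewrite -z_lt (le_lt_trans h).
by apply: le_trans h1; rewrite z_le; lia.
Qed.

Lemma at_rank_mono c c' k k' : c <= c' -> at_rank c k z -> at_rank c' k' z -> k <= k'.
Proof.
move=> cc' [h1 _] h'.
have : k - 1 < k' by rewrite -(at_rank_le _ h') (le_trans h1).
lia.
Qed.

Lemma at_rank_uniq c k k' : at_rank c k z -> at_rank c k' z -> k = k'.
Proof.
by move=> h h'; apply/le_anti; rewrite !(at_rank_mono (lexx c) h h') (at_rank_mono (lexx c) h' h).
Qed.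

Lemma at_rank_exists c : two_sided z -> exists k, at_rank c k z.
Proof.
move=> [/(_ c)[i1 ci1] /(_ c)[i0 ci0]].
have [||k [zk kmax]] := @int_max_exists (fun i => z i <= c) i1.
- by exists i0.
- by move=> i zi; rewrite -z_le; rewrite (le_trans zi) // ltW.
exists (k + 1); split; first by rewrite addrK.
by rewrite ltNge; apply/negP => /kmax; lia.
Qed.

Lemma card_int_range (n : int) (k : nat) : [set i : int | n <= i < n + k%:Z] #= `I_k.
Proof.
have -> : [set i : int | n <= i < n + k%:Z] = (fun m : nat => n + m%:Z) @` `I_k.
  apply/seteqP; split => i /=.
    by move=> h; exists `|i - n|%N => /=; lia.
  by move=> [m /= mk <-]; lia.
by apply: inj_card_eq => x y _ _; lia.
Qed.

Lemma count_at a b n k : at_rank a n z -> at_rank b (n + k%:Z) z ->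
  [set i | a < z i <= b] #= `I_k.
Proof.
move=> ha hb; rewrite (_ : [set i | _] = [set i : int | n <= i < n + k%:Z]).
  exact: card_int_range.
apply/seteqP; split => i /=; rewrite [a < _]ltNge (at_rank_le _ ha) (at_rank_le _ hb) -leNgt //.
Qed.

Lemma count_at_inv a b n m k : a <= b -> at_rank a n z -> at_rank b m z ->
  [set i | a < z i <= b] #= `I_k -> m = n + k%:Z.
Proof.
move=> ab ha hb hk; have nm := at_rank_mono ab ha hb.
have e : m = n + `|m - n|%N by lia.
rewrite e in hb; have h := count_at ha hb.
have : `I_k #= `I_(`|m - n|%N) by rewrite (card_eq_trans _ h) // card_eq_sym.
by move=> /card_eq_II; lia.
Qed.

(** Positivity of [k] provides a point in the interval. If there were no point on one side, all
    labels from that point on in that direction would lie in the interval, against finiteness; so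
    both ranks exist. *)
Lemma count_event_at a b k : a <= b -> (0 < k)%N ->
  [set i | a < z i <= b] #= `I_k <-> exists n, at_rank a n z /\ at_rank b (n + k%:Z) z.
Proof.
move=> ab k0; split=> [h|[n [ha hb]]]; last exact: count_at ha hb.
have finA : finite_set [set i | a < z i <= b] by exists k.
have [i0 /andP[ai0 i0b]] : [set i | a < z i <= b] !=set0.
  apply/set0P/eqP => e; move: h; rewrite e card_eq_sym card_eq0 => /eqP e0.
  have : `I_k 0%N by [].
  by rewrite e0.
have lo : exists i, z i <= a.
  apply: contrapT => nlo; have za i : a < z i by rewrite ltNge; apply/negP => ?; apply: nlo; exists i.
  have : infinite_set [set i | a < z i <= b]; last by [].
  apply: (@sub_infinite_set _ ((fun m : nat => i0 - m%:Z) @` setT)).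
    by move=> _ [m _ <-] /=; rewrite za /=; apply: le_trans i0b; rewrite z_le; lia.
  by apply: infinite_image => x y; lia.
have hi : exists i, b < z i.
  apply: contrapT => nhi; have zb i : z i <= b by rewrite leNgt; apply/negP => ?; apply: nhi; exists i.
  have : infinite_set [set i | a < z i <= b]; last by [].
  apply: (@sub_infinite_set _ ((fun m : nat => i0 + m%:Z) @` setT)).
    by move=> _ [m _ <-] /=; rewrite zb andbT; apply: (lt_le_trans ai0); rewrite z_le; lia.
  by apply: infinite_image => x y; lia.
have [ia zia] := lo; have [ib zib] := hi.
have [||n [zn nmax]] := @int_max_exists (fun i => z i <= a) i0.
- by exists ia.
- by move=> i zi; rewrite -z_le (le_trans zi) // ltW.
have [||m [zm mmax]] := @int_max_exists (fun i => z i <= b) ib.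
- by exists i0.
- by move=> i zi; rewrite -z_le (le_trans zi) // ltW.
have hn : at_rank a (n + 1) z.
  by split; rewrite ?addrK // ltNge; apply/negP => /nmax; lia.
have hm : at_rank b (m + 1) z.
  by split; rewrite ?addrK // ltNge; apply/negP => /mmax; lia.
by exists (n + 1); rewrite -(count_at_inv ab hn hm h).
Qed.

End Increasing.
End Enumeration.

(** * Configurations up to relabelling *)

Section SequenceSpaces.
Context {R : realType}.
Local Notation Om := (@Omega R).

Definition shift_seq (n : int) (s : int -> R) : int -> R := fun i => s (i + n).

Definition shiftO (n : int) (w : Om) : Om := (shift_seq n w.1, shift_seq n w.2).

(** A pi-system: the points are constrained only through finitely many inequalities z_i <= c, which
    translate into conditions on ranks, and the marks through an arbitrary event. *)
Definition cylinders : set (set Om) := [set E | exists (s : seq (int * R)) B,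
  seq_sigma B /\ E = [set w : Om | (forall p, p \in s -> w.1 p.1 <= p.2) /\ B w.2]].

Lemma cylinders_setI : setI_closed cylinders.
Proof.
move=> _ _ [s [B [sB ->]]] [s' [B' [sB' ->]]]; exists (s ++ s'), (B `&` B'); split.
  exact: (@measurableI _ (g_sigma_algebraType _)).
apply/seteqP; split => w /=.
  move=> [[h b] [h' b']]; split=> // p; rewrite mem_cat => /orP[]; [exact: h|exact: h'].
move=> [h [b b']]; split; split=> // p ps; apply: h; rewrite mem_cat ps ?orbT //.
Qed.

Lemma seq_sigma_shift n B : @seq_sigma R B -> seq_sigma (shift_seq n @^-1` B).
Proof.
apply: sigma_preimage; first exact: smallest_sigma_algebra.
move=> _ [i [B' [mB' ->]]]; apply: sub_sigma_algebra.
by exists (i + n), B'.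
Qed.

Lemma shift_seqD m n s : shift_seq n (shift_seq m s) = shift_seq (n + m) s.
Proof. by apply/funext => i; rewrite /shift_seq addrA. Qed.

End SequenceSpaces.

Section MeasurableFamilies.
Context {d : measure_display} {T : measurableType d} {R : realType}.

Lemma measurable_all_seq (I : eqType) (s : seq I) (F : I -> set T) :
  (forall c, measurable (F c)) -> measurable [set w | forall c, c \in s -> F c w].
Proof.
move=> mF; elim: s => [|c s ih].
  by have -> : [set w | forall c, c \in [::] -> F c w] = setT by apply/seteqP; split.
have -> : [set w | forall c', c' \in c :: s -> F c' w] =
    F c `&` [set w | forall c, c \in s -> F c w].
  apply/seteqP; split => w /=.
    by move=> h; split=> [|c' c's]; apply: h; rewrite inE ?eqxx ?c's ?orbT.
  by move=> [Fc h] c'; rewrite inE => /predU1P[->//|]; exact: h.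
exact: measurableI.
Qed.

Lemma measurable_le_cst (f : T -> R) c : measurable_fun setT f -> measurable [set w | f w <= c].
Proof.
move=> mf; have := mf measurableT _ (measurable_itv `]-oo, c]).
by rewrite setTI; congr (measurable _); apply/seteqP; split => w /=; rewrite in_itv.
Qed.

Lemma measurable_gt_cst (f : T -> R) c : measurable_fun setT f -> measurable [set w | c < f w].
Proof.
move=> /(measurable_le_cst c) /measurableC; congr (measurable _).
by apply/seteqP; split => w /=; rewrite ltNge => /negP.
Qed.

Variable X : int -> T -> R.
Hypothesis mX : forall i, measurable_fun setT (X i).

Lemma measurable_at_rank c k : measurable [set w | at_rank c k (path_of X w)].
Proof.
apply: (@measurableI _ _ [set w | X (k - 1) w <= c] [set w | c < X k w]).
  exact: measurable_le_cst.
exact: measurable_gt_cst.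
Qed.

Lemma measurable_two_sided : measurable [set w | two_sided (path_of X w)].
Proof.
have -> : [set w | two_sided (path_of X w)] =
    [set w | forall n : nat, exists i, n%:R < X i w] `&`
    [set w | forall n : nat, exists i, X i w <= - n%:R].
  apply/seteqP; split => w /= [h1 h2]; split => // c.
    have [i hi] := h1 (Num.truncn c).+1; exists i.
    exact: (lt_trans (truncnS_gt _)).
  have [i hi] := h2 (Num.truncn (- c)).+1; exists i; apply: (le_trans hi).
  by rewrite lerNl ltW // truncnS_gt.
apply: measurableI; apply: measurable_all => n; apply: measurable_ex => i.
  exact: measurable_gt_cst.
exact: measurable_le_cst.
Qed.

Lemma measurable_path B : seq_sigma B -> measurable (path_of X @^-1` B).
Proof.
apply: sigma_preimage; first exact: sigma_algebra_measurable.
by move=> _ [i [B' [mB' ->]]]; have := mX i measurableT mB'; rewrite setTI.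
Qed.

End MeasurableFamilies.

Section ProcSigma.
Context {d : measure_display} {T : measurableType d} {R : realType}.
Variable X : int -> T -> R.

Lemma proc_sigma_at_rank c k : proc_sigma X [set w | at_rank c k (path_of X w)].
Proof.
apply: (@measurable_at_rank _ (g_sigma_algebraType
  [set A | exists (i : int) (B : set R), measurable B /\ A = X i @^-1` B])).
move=> i _ B mB; rewrite setTI; apply: sub_sigma_algebra.
by exists i, B.
Qed.

Lemma proc_sigma_path B : seq_sigma B -> proc_sigma X (path_of X @^-1` B).
Proof.
apply: sigma_preimage; first exact: smallest_sigma_algebra.
by move=> _ [i [B' [mB' ->]]]; apply: sub_sigma_algebra; exists i, B'.
Qed.

Lemma proc_sigmaI A B : proc_sigma X A -> proc_sigma X B -> proc_sigma X (A `&` B).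
Proof. exact: (@measurableI _ (g_sigma_algebraType _)). Qed.

Lemma proc_sigma_all_seq (I : eqType) (s : seq I) (F : I -> set T) :
  (forall c, proc_sigma X (F c)) -> proc_sigma X [set w | forall c, c \in s -> F c w].
Proof. exact: (@measurable_all_seq _ (g_sigma_algebraType _)). Qed.

Lemma stationary_shift (P : probability T R) : stationary P X ->
  forall B n, seq_sigma B -> P (path_of X @^-1` (shift_seq n @^-1` B)) = P (path_of X @^-1` B).
Proof.
move=> [_ statX] B n sB.
have step m : P (path_of X @^-1` (shift_seq (m + 1) @^-1` B)) =
              P (path_of X @^-1` (shift_seq m @^-1` B)).
  rewrite [RHS]statX; last exact: seq_sigma_shift.
  by congr (P _); apply/seteqP; split => w /=; rewrite -shift_seqD.
move: n; apply: int_ind_both.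
- by congr (P _); apply/seteqP; split => w /=; rewrite /shift_seq; under eq_fun do rewrite addr0.
- by move=> j; rewrite step.
- by move=> j; rewrite step.
Qed.

End ProcSigma.

(** * Invariance under the nonlinear shift *)

Section Invariance.
Context {R : realType} {d : measure_display} {T : measurableType d}.
Variables (P : probability T R) (lam : R -> R) (Z H : int -> T -> R).
Hypotheses (clam : continuous lam) (lam_gt0 : forall y, 0 < lam y).
Hypothesis lam_left :
  (\int[lebesgue_measure]_(u in `]-oo, 0%R]) (lam u)%:E = +oo)%E.
Hypothesis lam_right :
  (\int[lebesgue_measure]_(u in `[0%R, +oo[) (lam u)%:E = +oo)%E.
Hypotheses (PP : poisson_process P lam Z) (statH : stationary P H).
Hypothesis indepZH : indep_processes P Z H.

Local Notation th := (theta lam).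
Local Notation zz := (path_of Z).
Local Notation om := (omega_of Z H).
Local Notation G0 := [set w | two_sided (path_of Z w)].

Let mZ i : measurable_fun setT (Z i). Proof. by case: PP. Qed.
Let Zstep w i : zz w i < zz w (i + 1). Proof. by case: PP => _ [h _]; exact: h. Qed.
Let Z0 w : Z (-1) w <= 0 < Z 0 w. Proof. by case: PP => _ [_ []]. Qed.
Let mH i : measurable_fun setT (H i). Proof. by case: statH. Qed.
Let th_lt t : {mono th t : x y / x < y}. Proof. exact: theta_lt. Qed.
Let th_le t : {mono th t : x y / x <= y}.
Proof. by move=> x y; rewrite !leNgt th_lt. Qed.
Let mG0 : measurable G0. Proof. exact: measurable_two_sided. Qed.

Let at0 w : at_rank 0 0 (zz w).
Proof. by have /andP[? ?] := Z0 w; split; rewrite ?sub0r. Qed.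

Lemma count_eventE a b k w : a <= b -> (0 < k)%N ->
  count_event Z a b k w <-> exists n, at_rank a n (zz w) /\ at_rank b (n + k%:Z) (zz w).
Proof. by move=> ab k0; exact: (count_event_at (Zstep w) ab k0). Qed.

Lemma count_event0 a b w : count_event Z a b 0%N w <-> forall i, ~ (a < Z i w <= b).
Proof.
rewrite /count_event /= II0 card_eq0; split=> [/eqP e i hi|h].
  by have : [set i : int | a < Z i w <= b] i by []; rewrite e.
by apply/eqP/seteqP; split => // i /h.
Qed.

Lemma measurable_count_event a b k : a <= b -> measurable (count_event Z a b k).
Proof.
move=> ab; case: k => [|k].
  have -> : count_event Z a b 0%N = [set w | forall i, (~` [set w | a < Z i w <= b]) w].
    by apply/seteqP; split => w /count_event0.
  apply: measurable_all => i; apply: measurableC.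
  have -> : [set w | a < Z i w <= b] = [set w | a < Z i w] `&` [set w | Z i w <= b].
    by apply/seteqP; split => w /=; [move/andP|move=> [-> ->]].
  apply: measurableI; [exact: measurable_gt_cst|exact: measurable_le_cst].
have -> : count_event Z a b k.+1 = [set w | exists n,
    ([set w | at_rank a n (zz w)] `&` [set w | at_rank b (n + k.+1%:Z) (zz w)]) w].
  by apply/seteqP; split => w /(count_eventE w ab (ltn0Sn k)).
by apply: measurable_ex => n; apply: measurableI; exact: measurable_at_rank.
Qed.

Lemma prob_count_event a b k : a < b ->
  P (count_event Z a b k) = (poisson_pmf (oint lam a b) k)%:E.
Proof.
move=> ab; have [_ [_ [_ /(_ 1%N (fun j => if j is 0%N then a else b) (fun=> k))]]] := PP.
rewrite big_ord1 /= => <-; last by case.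
by congr (P _); apply/seteqP; split => w /=; [move=> h [|//]|move=> h; exact: (h 0%N)].
Qed.

Lemma prob_count_event_ex a b : a < b -> P [set w | exists k, count_event Z a b k w] = 1%E.
Proof.
move=> ab; have -> : [set w | exists k, count_event Z a b k w] = \bigcup_k count_event Z a b k.
  by apply/seteqP; split => w [k]; [exists k|move=> _; exists k].
rewrite measure_semi_bigcup.
- rewrite (eq_eseriesr (fun k _ => prob_count_event k ab)).
  by apply: poisson_pmf_sum; exact: oint_gt0.
- by move=> k; apply: measurable_count_event; exact: ltW.
- move=> i j _ _ [w [wi wj]]; apply/card_eq_II.
  by rewrite (card_eq_trans _ wj) // card_eq_sym.
- by apply: bigcup_measurable => k _; apply: measurable_count_event; exact: ltW.
Qed.

(** Almost surely the counts on the intervals (0, n+1] and (-n-1, 0] are all finite, and a finite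
    count forces a point beyond the far end. *)
Lemma prob_two_sided : P G0 = 1%E.
Proof.
pose C n := [set w | exists k, count_event Z 0 n.+1%:R k w] `&`
            [set w | exists k, count_event Z (- n.+1%:R) 0 k w].
have m0 n : measurable [set w | exists k, count_event Z 0 n.+1%:R k w].
  by apply: measurable_ex => k; apply: measurable_count_event.
have m1 n : measurable [set w | exists k, count_event Z (- n.+1%:R) 0 k w].
  by apply: measurable_ex => k; apply: measurable_count_event; rewrite oppr_le0.
have C1 : P [set w | forall n, C n w] = 1%E.
  apply: prob_full_forall => n; first exact: measurableI.
  by rewrite probI_full ?prob_count_event_ex // oppr_lt0.
apply/eqP; rewrite eq_le probability_le1 //= -C1.
apply: le_measure; rewrite ?inE //.
  by apply: measurable_all => n; exact: measurableI.
move=> w h; split=> c.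
  (* A positive count yields a point on the right through the ranks; a zero count means that the
     positive point [Z 0] itself lies beyond. *)
  have [[[|k] hk] _] := h (Num.truncn c).
    exists 0; apply: lt_trans (truncnS_gt _) _; rewrite ltNge; apply/negP => z0.
    by move/count_event0: hk => /(_ 0); apply; have /andP[_ ->] := Z0 w.
  have /(count_eventE w _ (ltn0Sn k))[|n [_ [_ hn]]] := hk; first by [].
  by exists (n + k.+1%:Z); apply: lt_trans (truncnS_gt _) hn.
have [_ [[|k] hk]] := h (Num.truncn (- c)).
  exists (-1); apply: (@le_trans _ _ (- (Num.truncn (- c)).+1%:R)); last first.
    by rewrite lerNl ltW // truncnS_gt.
  rewrite leNgt; apply/negP => z0.
  by move/count_event0: hk => /(_ (-1)); apply; have /andP[-> _] := Z0 w; rewrite z0.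
have /(count_eventE w _ (ltn0Sn k))[|n [[hn _] _]] := hk; first by rewrite oppr_le0.
by exists (n - 1); rewrite (le_trans hn) // lerNl ltW // truncnS_gt.
Qed.

(** The ranks are measured relative to the rank [n] at the shifted base point [b], so that the union
    over [n] does not depend on the labelling. *)
Definition rank_gaps u b (s : seq R) (kap : R -> int) n : set T :=
  [set w | at_rank (th u b) n (zz w)] `&`
  [set w | forall c, c \in s -> at_rank (th u c) (kap c + n) (zz w)].

Lemma measurable_rank_gaps u b s kap n : measurable (rank_gaps u b s kap n).
Proof.
apply: measurableI; first exact: measurable_at_rank.
by apply: measurable_all_seq => c; exact: measurable_at_rank.
Qed.

(* The increments of the counting function of the points along the sorted list
   [b :: s] are independent Poisson variables, and [theta] preserves their means. *)
Lemma prob_rank_gaps b s kap : exists F,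
  forall u, P [set w | exists n, rank_gaps u b s kap n w] = F.
Proof.
have [/andP[bs kb0]|kb] := boolP ((b \in s) && (kap b != 0)).
  exists 0%E => u; rewrite (_ : [set w | _] = set0) ?measure0 //.
  apply/seteqP; split => // w [n [/= h /(_ b bs) h']].
  have := at_rank_uniq (Zstep w) h h'; move/eqP: kb0; lia.
(* The relative rank of the base point is 0; the inconsistent prescriptions at [b] were discarded as
   the empty event. *)
pose k' c := if c == b then 0 else kap c.
pose pts := sort <=%R (undup (b :: s)).
pose m := (size pts).-1.
have szp : size pts = m.+1.
  rewrite /m prednK // size_sort -has_predT; apply/hasP; exists b => //.
  by rewrite mem_undup inE eqxx.
pose t j := nth b pts j.
have tlt i j : (i < j)%N -> (j <= m)%N -> t i < t j.
  move=> ij jm; have srt : sorted <%R pts.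
    by rewrite lt_sorted_uniq_le sort_uniq undup_uniq sort_sorted //; exact: le_total.
  by rewrite /t (sorted_ltn_nth lt_trans) // ?inE ?szp // ltnS // (leq_trans _ jm) // ltnW.
have relE u w : (exists n, rank_gaps u b s kap n w) <->
    exists n, forall j, (j <= m)%N -> at_rank (th u (t j)) (k' (t j) + n) (zz w).
  have memp c : (c \in pts) = (c \in b :: s) by rewrite mem_sort mem_undup.
  split=> -[n hn]; exists n.
    move=> j jm; have : t j \in b :: s by rewrite -memp mem_nth // szp ltnS.
    rewrite inE /k'; case: eqP => [-> _|_ /= ts]; first by rewrite add0r; case: hn.
    by case: hn => _; apply.
  have hc c : c \in b :: s -> at_rank (th u c) (k' c + n) (zz w).
    rewrite -memp => cp; have := hn (index c pts).
    by rewrite /t nth_index // -ltnS -szp index_mem => /(_ cp).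
  split => [|c cs] /=; first by have := hc b; rewrite inE eqxx /k' eqxx add0r; apply.
  have := hc c; rewrite inE cs orbT => /(_ isT); rewrite /k'; case: eqP => // cb.
  by move: kb; rewrite -cb cs /= negbK => /eqP ->.
have [/forallP kmono|] := boolP [forall j : 'I_m, k' (t j) <= k' (t j.+1)]; last first.
  rewrite negb_forall => /existsP[j]; rewrite -ltNge => kj.
  exists 0%E => u; rewrite (_ : [set w | _] = set0) ?measure0 //.
  apply/seteqP; split => // w /relE[n hn].
  have := at_rank_mono (Zstep w) _ (hn j (ltnW (ltn_ord j))) (hn j.+1 (ltn_ord j)).
  rewrite th_le ltW ?tlt // => /(_ isT); lia.
pose k j := `|k' (t j.+1) - k' (t j)|%N.
have kE j : (j < m)%N -> k' (t j.+1) = k' (t j) + (k j)%:Z.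
  by move=> jm; have := kmono (Ordinal jm); rewrite /k /=; lia.
exists (\prod_(j < m) poisson_pmf (oint lam (t j) (t j.+1)) (k j))%:E => u.
have thlt j : (j < m)%N -> th u (t j) < th u (t j.+1) by move=> jm; rewrite th_lt tlt.
have -> : \prod_(j < m) poisson_pmf (oint lam (t j) (t j.+1)) (k j) =
    \prod_(j < m) poisson_pmf (oint lam (th u (t j)) (th u (t j.+1))) (k j).
  by apply: eq_bigr => j _; congr (poisson_pmf _ _); apply/esym; exact: oint_theta.
have [_ [_ [_ PPm]]] := PP.
rewrite -(PPm m (fun j => th u (t j)) k thlt) => {PPm}.
have mrel : measurable [set w | exists n, rank_gaps u b s kap n w].
  by apply: measurable_ex => n; exact: measurable_rank_gaps.
have mcap : measurable (\bigcap_(j in [set j | (j < m)%N])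
    count_event Z (th u (t j)) (th u (t j.+1)) (k j)).
  by apply: bigcap_measurableType => j jm; exact/measurable_count_event/ltW/thlt.
rewrite -(probI_full mG0 prob_two_sided mrel) -(probI_full mG0 prob_two_sided mcap).
congr (P _); apply/seteqP; split => w [w0]; last first.
  move=> hw; split=> //; apply/relE.
  have [r hr] := at_rank_exists (Zstep w) (th u (t 0%N)) w0.
  (* On a two-sided configuration the rank at the leftmost time and the successive counts determine
     all ranks; subtracting the prescribed relative rank gives the rank at [b]. *)
  exists (r - k' (t 0%N)); elim=> [|j ih] jm; first by rewrite subrKC.
  have [q hq] := at_rank_exists (Zstep w) (th u (t j.+1)) w0.
  have := count_at_inv (Zstep w) (ltW (thlt _ jm)) (ih (ltnW jm)) hq (hw j jm).
  by rewrite (kE _ jm) => e; rewrite addrAC -e.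
move=> /relE[n hn]; split => // j jm.
have hj : at_rank (th u (t j.+1)) (k' (t j) + n + (k j)%:Z) (zz w).
  by rewrite addrAC -kE //; apply: hn.
exact: (count_at (Zstep w) (hn j (ltnW jm)) hj).
Qed.

(** The shifted configuration, renumbered so that label 0 is again the first positive point: a
    shifted point is positive exactly when the original lies after [th (- u) 0]. Elsewhere the
    default [om w] makes [relabel] and [om] coincide. *)
Definition relabel u w : Omega :=
  if `[< two_sided (zz w) >]
  then shiftO (xget 0 [set n | at_rank (th (- u) 0) n (zz w)]) (thetaO lam u (om w))
  else om w.

Lemma relabelE u w n : two_sided (zz w) -> at_rank (th (- u) 0) n (zz w) ->
  relabel u w = shiftO n (thetaO lam u (om w)).
Proof.
move=> w0 hn; rewrite /relabel; case: asboolP => // _.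
case: xgetP => [m _ /(at_rank_uniq (Zstep w) hn) -> //|/(_ n)]; by move/(_ hn).
Qed.

Lemma relabel_step u w i : (relabel u w).1 i < (relabel u w).1 (i + 1).
Proof.
rewrite /relabel; case: asboolP => _; last exact: Zstep.
by rewrite /= /shift_seq /= th_lt addrAC; apply: Zstep.
Qed.

Lemma relabel_two_sided u w : two_sided (zz w) -> two_sided (relabel u w).1.
Proof.
move=> w0; have [n hn] := at_rank_exists (Zstep w) (th (- u) 0) w0.
have thK c : th u (th (- u) c) = c by rewrite thetaD // subrr theta0.
rewrite (relabelE w0 hn); split=> c.
  have [i hi] := w0.1 (th (- u) c); exists (i - n).
  by rewrite /= /shift_seq /= subrK -[ltLHS]thK th_lt.
have [i hi] := w0.2 (th (- u) c); exists (i - n).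
by rewrite /= /shift_seq /= subrK -[leRHS]thK th_le.
Qed.

Lemma relabel_at_rank u w n c k : two_sided (zz w) -> at_rank (th (- u) 0) n (zz w) ->
  at_rank c k (relabel u w).1 <-> at_rank (th (- u) c) (k + n) (zz w).
Proof.
move=> w0 hn; have thK : th u (th (- u) c) = c by rewrite thetaD // subrr theta0.
rewrite (relabelE w0 hn) /at_rank /= /shift_seq /= addrAC.
by rewrite -[X in (_ <= X) /\ _]thK -[X in _ /\ (X < _)]thK th_le th_lt.
Qed.

(** A mixture of rank conditions ([s], [kap]) and inequalities on points ([s2]): cylinders have [s]
    empty, events accessible to the Poisson counts have [s2] empty. *)
Definition rank_event (f : T -> Omega) (s : seq R) (kap : R -> int) (s2 : seq (int * R)) (B : set (int -> R)) : set T :=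
  [set w | [/\ two_sided (zz w), forall c, c \in s -> at_rank c (kap c) (f w).1,
     forall p, p \in s2 -> (f w).1 p.1 <= p.2 & B (f w).2]].

(** The event is split according to the label [n] of the first point after [th (- u) 0]. For each
    [n], independence separates points from marks and stationarity removes the shift of the marks by
    [n]; the point parts then add up to the probability of prescribed relative ranks, which does not
    depend on the time shift. *)
Lemma rank_event_nil u s kap B : seq_sigma B ->
  [/\ measurable (rank_event om s kap [::] B), measurable (rank_event (relabel u) s kap [::] B)
    & P (rank_event om s kap [::] B) = P (rank_event (relabel u) s kap [::] B)].
Proof.
move=> sB; have [F hF] := prob_rank_gaps 0 s kap.
pose X n := rank_gaps (- u) 0 s kap n.
pose Y n := path_of H @^-1` (shift_seq n @^-1` B).
pose S := [set w | forall c, c \in s -> at_rank c (kap c) (zz w)].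
have mS : measurable S by apply: measurable_all_seq => c; exact: measurable_at_rank.
have mX n : measurable (X n) by exact: measurable_rank_gaps.
have mY n : measurable (Y n) by apply: measurable_path => //; exact: seq_sigma_shift.
have mB : measurable (path_of H @^-1` B) by exact: measurable_path.
have e1 : rank_event om s kap [::] B = G0 `&` (S `&` path_of H @^-1` B).
  by apply/seteqP; split => w; [move=> []|move=> [? []]; split].
have e2 : rank_event (relabel u) s kap [::] B = G0 `&` [set w | exists n, (X n `&` Y n) w].
  apply/seteqP; split => w.
    move=> [w0 hs _ hB]; split => //.
    have [n hn] := at_rank_exists (Zstep w) (th (- u) 0) w0.
    exists n; split; last by move: hB; rewrite (relabelE w0 hn).
    by split => // c cs; apply/relabel_at_rank => //; apply: hs.
  move=> [w0 [n [[hn hs] hB]]]; split => //; last by rewrite (relabelE w0 hn).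
  by move=> c cs; apply/(relabel_at_rank _ _ w0 hn); exact: hs.
have mXY : measurable [set w | exists n, (X n `&` Y n) w].
  by apply: measurable_ex => n; exact: measurableI.
have mSB : measurable (S `&` path_of H @^-1` B) by exact: measurableI.
rewrite e1 e2; split; try exact: measurableI.
rewrite (probI_full mG0 prob_two_sided mSB) (probI_full mG0 prob_two_sided mXY).
have pB : P (path_of H @^-1` B) = (fine (P (path_of H @^-1` B)))%:E.
  by rewrite fineK // fin_num_measure.
rewrite indepZH; last 2 first.
- by apply: proc_sigma_all_seq => c; exact: proc_sigma_at_rank.
- exact: proc_sigma_path.
rewrite (prob_ex_scale (B := X) (c := fine (P (path_of H @^-1` B)))) //.
- rewrite -pB [RHS]muleC; congr (_ * _)%E; rewrite [RHS]hF -(hF 0); congr (P _).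
  apply/seteqP; split => w /=.
    move=> hs; exists 0; split => /=; first by rewrite theta0.
    by move=> c cs; rewrite theta0 // addr0; exact: hs.
  move=> [n []] /=; rewrite theta0 // => /(at_rank_uniq (Zstep w) (at0 w)) <- hs c cs.
  by have := hs c cs; rewrite theta0 // addr0.
- by move=> n; exact: measurableI.
- by move=> i j w [[hi _] _] [[hj _] _]; exact: (at_rank_uniq (Zstep w) hi hj).
- by move=> i j w [hi _] [hj _]; exact: (at_rank_uniq (Zstep w) hi hj).
move=> n; rewrite indepZH.
- by rewrite -pB muleC stationary_shift.
- apply: proc_sigmaI; first exact: proc_sigma_at_rank.
  by apply: proc_sigma_all_seq => c; exact: proc_sigma_at_rank.
- by apply: proc_sigma_path; exact: seq_sigma_shift.
Qed.

(** Since z_i <= c means that [i] is less than the rank at [c], the inequality is decided when this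
    rank is prescribed; otherwise the event splits over the possible ranks [k > i]. *)
Lemma rank_event_cons f s kap i c s2 B :
    (forall w i, (f w).1 i < (f w).1 (i + 1)) ->
    (forall w, two_sided (zz w) -> two_sided (f w).1) ->
  rank_event f s kap ((i, c) :: s2) B =
  if c \in s then (if i < kap c then rank_event f s kap s2 B else set0)
  else [set w | exists k, i < k /\
         rank_event f (c :: s) (fun x => if x == c then k else kap x) s2 B w].
Proof.
move=> fstep f0.
have hcons w : (forall p, p \in (i, c) :: s2 -> (f w).1 p.1 <= p.2) <->
    (f w).1 i <= c /\ forall p, p \in s2 -> (f w).1 p.1 <= p.2.
  split=> [h|[hi h] p]; last by rewrite inE => /predU1P[->//|/h].
  by split=> [|p ps]; [apply: (h (i, c))|apply: h]; rewrite inE ?eqxx ?ps ?orbT.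
have [cs|cs] := boolP (c \in s).
  have hi w : (forall c, c \in s -> at_rank c (kap c) (f w).1) -> ((f w).1 i <= c) = (i < kap c).
    by move=> hs; apply: (at_rank_le (fstep w)); exact: hs.
  case: ifPn => ik; apply/seteqP; split => w //.
  - by move=> [w0 hs /hcons[_ ?] hB]; split.
  - by move=> [w0 hs h hB]; split => //; apply/hcons; split => //; rewrite hi.
  - by move=> [w0 hs /hcons[]]; rewrite hi // (negbTE ik).
apply/seteqP; split => w.
  move=> [w0 hs /hcons[fi h2] hB].
  have [k hk] := at_rank_exists (fstep w) c (f0 _ w0).
  exists k; split; first by rewrite -(at_rank_le (fstep w) _ hk).
  split => // x; rewrite inE => /predU1P[->|xs]; first by rewrite eqxx.
  case: eqP => [xc|_]; last exact: hs.
  by move: cs; rewrite -xc xs.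
move=> [k [ik [w0 hs h2 hB]]]; have := hs c; rewrite inE eqxx => /(_ isT) hk.
split => //; last by apply/hcons; split=> //; rewrite (at_rank_le (fstep w) _ hk).
move=> x xs; have := hs x; rewrite inE xs orbT => /(_ isT).
by case: eqP => // xc; move: cs; rewrite -xc xs.
Qed.

(** Induction on the inequalities, each being traded for a disjoint union of rank conditions; [s]
    and [kap] must therefore vary. *)
Lemma rank_event_law u B s2 : seq_sigma B -> forall s kap,
  [/\ measurable (rank_event om s kap s2 B), measurable (rank_event (relabel u) s kap s2 B)
    & P (rank_event om s kap s2 B) = P (rank_event (relabel u) s kap s2 B)].
Proof.
move=> sB; elim: s2 => [|[i c] s2 ih] s kap; first exact: rank_event_nil.
rewrite !rank_event_cons //; [|exact: relabel_step|exact: relabel_two_sided].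
case: ifPn => cs; first by case: ifPn.
pose E f k := [set w | i < k /\
  rank_event f (c :: s) (fun x => if x == c then k else kap x) s2 B w].
have EE f k : E f k = if i < k
    then rank_event f (c :: s) (fun x => if x == c then k else kap x) s2 B else set0.
  by case: ifPn => ik; apply/seteqP; split => w //; [move=> []|move=> [ik']; rewrite ik' in ik].
have Euniq f k k' w : (forall w i, (f w).1 i < (f w).1 (i + 1)) -> E f k w -> E f k' w -> k = k'.
  move=> fstep [_ [_ h _ _]] [_ [_ h' _ _]].
  have := h c; have := h' c; rewrite inE eqxx => /(_ isT) ? /(_ isT).
  by move/(at_rank_uniq (fstep w)); apply.
have mE1 k : measurable (E om k).
  by rewrite EE; case: ifPn => // _; have [] := ih (c :: s) (fun x => if x == c then k else kap x).
have mE2 k : measurable (E (relabel u) k).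
  by rewrite EE; case: ifPn => // _; have [] := ih (c :: s) (fun x => if x == c then k else kap x).
split; [exact: (measurable_ex mE1)|exact: (measurable_ex mE2)|].
have := @prob_ex_scale _ _ _ P _ (E om) (E (relabel u)) 1 mE1 mE2.
rewrite mul1e; apply.
- by move=> k k' w; apply: Euniq.
- by move=> k k' w; apply: Euniq; exact: relabel_step.
- move=> k; rewrite mul1e !EE; case: ifPn => // _.
  by have [] := ih (c :: s) (fun x => if x == c then k else kap x).
Qed.

Lemma relabel_law u A : <<s cylinders >> A ->
  [/\ measurable (om @^-1` A), measurable (relabel u @^-1` A)
    & P (om @^-1` A) = P (relabel u @^-1` A)].
Proof.
apply: law_eq; first exact: cylinders_setI.
move=> _ [s2 [B [sB ->]]]; set C := [set w : Omega | _].
have e f : G0 `&` f @^-1` C = rank_event f [::] (fun=> 0) s2 B.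
  by apply/seteqP; split => w; [move=> [w0 []]|move=> [w0 _ h hB]].
have [m1 m2 e12] := rank_event_law u s2 sB [::] (fun=> 0).
have mom : measurable (om @^-1` C).
  apply: (@measurableI _ _ [set w | forall p, p \in s2 -> Z p.1 w <= p.2] (path_of H @^-1` B)).
    by apply: measurable_all_seq => p; exact: measurable_le_cst.
  exact: measurable_path.
have off : relabel u @^-1` C `\` G0 = om @^-1` C `\` G0.
  by apply/seteqP; split => w [h w0]; split => //; move: h; rewrite /= /relabel; case: asboolP.
have mrel : measurable (relabel u @^-1` C).
  have -> : relabel u @^-1` C = (relabel u @^-1` C `\` G0) `|` (G0 `&` relabel u @^-1` C).
    by rewrite setUC setIC setUIDK.
  by apply: measurableU; [rewrite off; exact: measurableD|rewrite e].
split => //.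
rewrite [LHS](measureDI P mom mG0) [RHS](measureDI P mrel mG0) off.
by rewrite (setIC (om @^-1` C)) (setIC (relabel u @^-1` C)) !e; congr (_ + _)%E; exact: e12.
Qed.

Definition shift_invariant (E : set (@Omega R)) := forall n w, E (shiftO n w) <-> E w.

(** On two-sided configurations [relabel] differs from the shift only by a renumbering, which [E]
    does not see. *)
Lemma theta_invariance E u : <<s cylinders >> E -> shift_invariant E ->
  measurable (G0 `&` [set w | E (thetaO lam u (om w))]) /\
  P (G0 `&` [set w | E (thetaO lam u (om w))]) = P (om @^-1` E).
Proof.
move=> sE invE; have [m1 m2 e] := relabel_law u sE.
have -> : G0 `&` [set w | E (thetaO lam u (om w))] = G0 `&` relabel u @^-1` E.
  by apply/seteqP; split => w [w0]; have [n hn] := at_rank_exists (Zstep w) (th (- u) 0) w0;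
    rewrite /= (relabelE w0 hn) => /invE.
by split; [exact: measurableI|rewrite probI_full // prob_two_sided].
Qed.

Lemma omega_of_measurable E : <<s cylinders >> E -> measurable (om @^-1` E).
Proof. by move=> /(relabel_law 0)[]. Qed.

End Invariance.

(** * The queue at a fixed time *)

Section CoordinateMeasurability.
Context {R : realType}.
Local Notation Om := (g_sigma_algebraType (@cylinders R)).

Lemma measurable_fun_of_le {d} {T : measurableType d} (f : T -> R) :
  (forall c, measurable [set w | f w <= c]) -> measurable_fun setT f.
Proof.
move=> mf mD; apply: (measurability _ (RGenOInfty.measurableE R)) => //.
move=> _ [_ [c ->] <-]; rewrite setTI.
have := measurableC (mf c); congr (measurable _).
by apply/seteqP; split => w /=; rewrite in_itv /= andbT ltNge => /negP.
Qed.

Lemma measurable_points i : measurable_fun setT (fun w : Om => w.1 i).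
Proof.
apply: measurable_fun_of_le => c; apply: sub_sigma_algebra.
exists [:: (i, c)], setT; split; first exact: (@measurableT _ (g_sigma_algebraType _)).
apply/seteqP; split => w /=; last by move=> [/(_ (i, c))]; rewrite inE eqxx => /(_ isT).
by move=> h; split => // p; rewrite inE => /eqP ->.
Qed.

Lemma measurable_marks i : measurable_fun setT (fun w : Om => w.2 i).
Proof.
move=> _ B mB; rewrite setTI; apply: sub_sigma_algebra.
exists [::], [set s | B (s i)]; split; first by apply: sub_sigma_algebra; exists i, B.
by apply/seteqP; split => w //= [].
Qed.

Lemma measurable_cumE {d} {T : measurableType d} (X : T -> int -> R) j :
  (forall i, measurable_fun setT (fun w => X w i)) ->
  measurable_fun setT (fun w => cumE (X w) j).
Proof.
move=> mX; case: j => n /=; first by apply: measurable_sum => i; exact: mX.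
by apply: measurableT_comp => //; apply: measurable_sum => i; exact: mX.
Qed.

Lemma measurable_gap i : measurable_fun setT (fun w : Om => gap w.1 w.2 i).
Proof.
apply: measurable_funB; first exact: measurable_points.
by apply: (measurable_cumE (X := fun w : Om => w.2)); exact: measurable_marks.
Qed.

(* [gap i + cumE (j + 1) = z_i + eta_i + ... + eta_j] *)
Definition path_end (w : @Omega R) i j : R := gap w.1 w.2 i + cumE w.2 j.

Lemma measurable_path_end i j : measurable_fun setT (fun w : Om => path_end w i j).
Proof.
apply: measurable_funD; first exact: measurable_gap.
by apply: (measurable_cumE (X := fun w : Om => w.2)); exact: measurable_marks.
Qed.

Lemma cumE_shift (s : int -> R) n j : cumE (shift_seq n s) j = cumE s (j + n) - cumE s n.
Proof.
move: j; apply: int_ind_both; first by rewrite cumE0 add0r subrr.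
- by move=> j ih; rewrite cumES ih (_ : j + 1 + n = j + n + 1) ?cumES /shift_seq; [ring|lia].
- move=> j; rewrite cumES (_ : j + 1 + n = j + n + 1) ?cumES /shift_seq; last by lia.
  by move=> h; lra.
Qed.

Lemma path_end_shift n w i j : path_end (shiftO n w) i j = path_end w (i + n) (j + n).
Proof. by rewrite /path_end /gap /= !cumE_shift {1}/shift_seq; ring. Qed.

Variable x : R.

(* [queue_ge m]: at least [m] customers that arrived by time [x] exit at time [x] or later. *)
Definition queue_ge (m : nat) : set (@Omega R) := [set w | exists j,
  at_rank x (j + m%:Z) w.1 /\ exists i, i <= j /\ x <= path_end w i (j + 1)].

(** Under regeneration the exit time is the maximum of the path ends. Expressing an exit at [x]
    through these makes measurability and invariance under renumbering accessible. *)
Definition exit_at : set (@Omega R) := [set w | exists j,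
  (forall i, i <= j -> path_end w i (j + 1) <= x) /\
  exists i, i <= j /\ path_end w i (j + 1) = x].

(** The rank [k] at [x] closes the chains with the last customer who arrived by [x]. Excluding this
    for all natural [c] makes the gaps tend to -oo. *)
Definition late_work (c : R) : set (@Omega R) := [set w | exists k,
  at_rank x k w.1 /\ forall n : nat, exists i : int, i <= - n%:Z /\ - c <= path_end w i k].

Let m_at (c : R) k : measurable ([set w | at_rank c k w.1] : set Om).
Proof. exact: (measurable_at_rank (X := fun i (w : Om) => w.1 i) measurable_points). Qed.

Let m_ge c i j : measurable ([set w | c <= path_end w i j] : set Om).
Proof.
have -> : [set w : Om | c <= path_end w i j] = [set w | - path_end w i j <= - c].
  by apply/seteqP; split => w /=; rewrite lerN2.
apply: measurable_le_cst; apply: measurableT_comp => //; exact: measurable_path_end.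
Qed.

Let m_le c i j : measurable ([set w | path_end w i j <= c] : set Om).
Proof. apply: measurable_le_cst; exact: measurable_path_end. Qed.

Let mI (A B : set Om) : measurable A -> measurable B -> measurable [set w | A w /\ B w].
Proof. exact: measurableI. Qed.

Lemma measurable_queue_ge m : <<s cylinders >> (queue_ge m).
Proof.
apply: (@measurable_ex _ Om) => j; apply: mI; first exact: m_at.
by apply: (@measurable_ex _ Om) => i; apply: mI; [exact: (@measurable_const _ Om (_ <= _))|exact: m_ge].
Qed.

Lemma measurable_exit_at : <<s cylinders >> exit_at.
Proof.
apply: (@measurable_ex _ Om) => j; apply: mI.
  have -> : (fun w : Om => forall i, i <= j -> path_end w i (j + 1) <= x) =
      [set w | forall i, (if i <= j then [set w | path_end w i (j + 1) <= x] else setT) w].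
    apply/seteqP; split => w /= h i; first by case: ifPn => //; exact: h.
    by move=> ij; have := h i; rewrite ij.
  by apply: measurable_all => i; case: ifPn.
apply: (@measurable_ex _ Om) => i; apply: mI; first exact: (@measurable_const _ Om (_ <= _)).
have -> : (fun w : Om => path_end w i (j + 1) = x) =
    [set w | x <= path_end w i (j + 1)] `&` [set w | path_end w i (j + 1) <= x].
  apply/seteqP; split => w /=; first by move=> ->.
  by move=> [h1 h2]; apply/le_anti; rewrite h1 h2.
exact: measurableI.
Qed.

Lemma measurable_late_work c : <<s cylinders >> (late_work c).
Proof.
apply: (@measurable_ex _ Om) => k; apply: mI; first exact: m_at.
apply: (@measurable_all _ Om) => n; apply: (@measurable_ex _ Om) => i.
by apply: mI; [exact: (@measurable_const _ Om (_ <= _))|exact: m_ge].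
Qed.

Lemma at_rank_shift n k (w : @Omega R) : at_rank x k (shiftO n w).1 <-> at_rank x (k + n) w.1.
Proof. by rewrite /at_rank /= /shift_seq addrAC. Qed.

Lemma shift_invariant_of E : (forall n w, E (shiftO n w) -> E w) -> @shift_invariant R E.
Proof.
move=> h n w; split; first exact: h.
have {1}-> : w = shiftO (- n) (shiftO n w); last exact: h.
by case: w => z e; congr (_, _); apply/funext => i; rewrite /= /shift_seq /= addrNK.
Qed.

Lemma queue_ge_invariant m : shift_invariant (queue_ge m).
Proof.
apply: shift_invariant_of => n w [j [/at_rank_shift hj [i [ij]]]].
rewrite path_end_shift => xi; exists (j + n); rewrite addrAC; split => //.
by exists (i + n); rewrite addrAC lerD2r.
Qed.

Lemma exit_at_invariant : shift_invariant exit_at.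
Proof.
apply: shift_invariant_of => n w [j [hle [i [ij]]]].
rewrite path_end_shift => xi; exists (j + n); split => [i' ij'|].
  have := hle (i' - n); rewrite path_end_shift subrK addrAC; apply.
  by rewrite lerBlDr.
by exists (i + n); rewrite addrAC lerD2r.
Qed.

Lemma late_work_invariant c : shift_invariant (late_work c).
Proof.
apply: shift_invariant_of => n w [k [/at_rank_shift hk h]].
exists (k + n); split => // m; have [i [im]] := h (m + `|n|)%N.
by rewrite path_end_shift => ci; exists (i + n); split => //; lia.
Qed.

End CoordinateMeasurability.

(** * Ranks of arrivals and exits for a configuration without late work *)

Section Regeneration.
Context {R : realType}.
Variables (w : @Omega R) (x : R).
Hypotheses (eta_gt0 : forall i, 0 < w.2 i) (z_step : forall i, w.1 i < w.1 (i + 1)).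
Hypotheses (z_two_sided : two_sided w.1) (no_late : forall c : nat, ~ late_work x c%:R w).

Lemma gap_to_minfty (M : R) : exists n : int, forall i, i <= n -> gap w.1 w.2 i < M.
Proof.
have [k hk] := at_rank_exists z_step x z_two_sided.
pose c := (Num.truncn (- (M + cumE w.2 k))).+1.
have cM : - c%:R < M + cumE w.2 k by rewrite ltrNl truncnS_gt.
apply: contrapT => h; apply: (no_late (c := c)); exists k; split => // n.
have [i [ilen Mi]] : exists i : int, i <= - n%:Z /\ M <= gap w.1 w.2 i.
  apply: contrapT => h'; apply: h; exists (- n%:Z) => i ilen.
  by rewrite ltNge; apply/negP => Mi; apply: h'; exists i.
by exists i; split => //; apply: (le_trans (ltW cM)); rewrite /path_end lerD2r.
Qed.

(** All gaps up to some [n'] lie below the gap at [n], so a maximum of the gap over the finite range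
    from [n'] to [n] is a maximum over the whole past. *)
Lemma gap_left_regen : left_regen w.1 w.2.
Proof.
move=> n; have [n' hn'] := gap_to_minfty (gap w.1 w.2 n).
have n'n : n' < n by rewrite ltNge; apply/negP => /hn'; rewrite ltxx.
have key (k : nat) : exists2 i, n - k%:Z <= i <= n &
    forall m, n - k%:Z <= m -> m <= n -> gap w.1 w.2 m <= gap w.1 w.2 i.
  elim: k => [|k [i ik imax]].
    exists n; first by rewrite subr0 lexx.
    by move=> m m1 m2; have -> : m = n by lia.
  have [h|h] := leP (gap w.1 w.2 (n - k.+1%:Z)) (gap w.1 w.2 i).
    exists i; first by lia.
    move=> m m1 m2; have [->//|mk] := eqVneq m (n - k.+1%:Z).
    by apply: imax => //; lia.
  exists (n - k.+1%:Z); first by lia.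
  move=> m m1 m2; have [->//|mk] := eqVneq m (n - k.+1%:Z).
  by apply: le_trans (ltW h); apply: imax => //; lia.
have [i ir imax] := key `|n - n'|%N.
exists i; first by lia.
move=> m mi; have [mn'|n'm] := leP m n'; last by apply: imax; lia.
apply: (le_trans (ltW (hn' _ mn'))); apply: imax; lia.
Qed.

Let spec := exit_time_spec eta_gt0 gap_left_regen.

Lemma exit_time_lt : {mono exit_time w : i j / i < j}.
Proof.
apply: leW_mono; apply: le_mono => i j ij.
have {ij} : i + 1 <= j by lia.
have step k : exit_time w k < exit_time w (k + 1).
  have [_ [i' ik <-]] := spec k; have [h _] := spec (k + 1).
  apply: lt_le_trans (h i' _); last by lia.
  by rewrite ltrD2l [ltRHS]cumES ltrDl.
move: j; apply: int_ind_up => // j _ /lt_trans; exact.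
Qed.

Lemma arrival_lt_exit j : w.1 j < exit_time w j.
Proof.
have [h _] := spec j; apply: lt_le_trans (h j (lexx _)).
by rewrite /gap cumES addrA subrK ltrDl.
Qed.

(** Exit times increase, so it suffices to find a last exit before [x]. Such exits are bounded above
    in label by the arrivals, and some exist because the gaps tend to -oo. *)
Lemma exit_rank_exists : exists D, forall j, (exit_time w j < x) = (j < D).
Proof.
have [k hk] := at_rank_exists z_step x z_two_sided.
have [n hn] := gap_to_minfty (x - cumE w.2 k).
have [||j [yj jmax]] := @int_max_exists (fun j => exit_time w j < x) k.
(* The label is at most [n], so all gaps involved are small, and at most [k - 1], so its accumulated
   service is at most [cumE w.2 k]. *)
- exists (Num.min n (k - 1)); have [_ [i ij <-]] := spec (Num.min n (k - 1)).
  have {}ij : i <= n /\ i <= k - 1 by move: ij; rewrite le_min => /andP[].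
  have := hn i ij.1; rewrite ltrBrDr; apply: le_lt_trans; rewrite lerD2l.
  apply: cumE_le => //; rewrite -[leRHS](subrK 1) lerD2r ge_min lexx orbT //.
- move=> j yj; have : w.1 j <= x by rewrite ltW // (lt_trans (arrival_lt_exit j)).
  by rewrite (at_rank_le z_step _ hk) => /ltW.
exists (j + 1) => i; apply/idP/idP; first by move=> /jmax; lia.
move=> ij; have [->//|nij] := eqVneq i j.
by apply: lt_trans yj; rewrite exit_time_lt; lia.
Qed.

Variables (A D : int).
Hypotheses (hA : at_rank x A w.1) (hD : forall j, (exit_time w j < x) = (j < D)).

Lemma exit_rank_le : D <= A.
Proof.
have : D - 1 < A; last by lia.
rewrite -(at_rank_le z_step _ hA) ltW // (lt_trans (arrival_lt_exit _)) // hD; lia.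
Qed.

(** Here [j] must be [A - m]: the queue has at least [m] customers exactly when this one does not
    exit before [x]. *)
Lemma queue_geE m : queue_ge x m w <-> D + m%:Z <= A.
Proof.
split=> [[j [hj [i [ij xi]]]]|h].
  have <- := at_rank_uniq z_step hj hA; rewrite lerD2r leNgt -hD -leNgt.
  have [h _] := spec j; exact: le_trans (h i ij).
exists (A - m%:Z); rewrite subrK; split => //.
have [_ [i ij e]] := spec (A - m%:Z); exists i; split => //.
by rewrite /path_end e leNgt hD; lia.
Qed.

Lemma exit_atE : exit_at x w <-> exists j, exit_time w j = x.
Proof.
split=> [[j [hle [i [ij e]]]]|[j yj]]; exists j.
  have [h [i' ij' e']] := spec j; apply/le_anti.
  by rewrite -{1}e' hle //= -{1}e h.
have [h [i ij e]] := spec j; rewrite -{1}yj; split=> //.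
by exists i; split; rewrite // /path_end e.
Qed.

End Regeneration.

(** * Stationarity and the mean displacement *)

Section Queue.
Context {R : realType} {d : measure_display} {T : measurableType d}.
Variables (P : probability T R) (lam : R -> R) (Z H : int -> T -> R).
Hypotheses (clam : continuous lam) (lam_gt0 : forall y, 0 < lam y).
Hypothesis lam_left :
  (\int[lebesgue_measure]_(u in `]-oo, 0%R]) (lam u)%:E = +oo)%E.
Hypothesis lam_right :
  (\int[lebesgue_measure]_(u in `[0%R, +oo[) (lam u)%:E = +oo)%E.
Hypotheses (PP : poisson_process P lam Z) (statH : stationary P H).
Hypothesis H_gt0 : forall i w, 0 < H i w.
Hypothesis indepZH : indep_processes P Z H.
Variable A0 : set T.
Hypotheses (mA0 : measurable A0) (A01 : P A0 = 1%E).
Hypothesis A0_bar : A0 `<=` omega_of Z H @^-1` Omega_bar lam.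

Local Notation th := (theta lam).
Local Notation zz := (path_of Z).
Local Notation om := (omega_of Z H).
Local Notation G0 := [set w | two_sided (path_of Z w)].

Let mZ i : measurable_fun setT (Z i). Proof. by case: PP. Qed.
Let Zstep w i : zz w i < zz w (i + 1). Proof. by case: PP => _ [h _]; exact: h. Qed.
Let mH i : measurable_fun setT (H i). Proof. by case: statH. Qed.
Let th_lt t : {mono th t : x y / x < y}. Proof. exact: theta_lt. Qed.
Let th_le t : {mono th t : x y / x <= y}.
Proof. by move=> x y; rewrite !leNgt th_lt. Qed.
Let thK t x : th t (th (- t) x) = x. Proof. by rewrite thetaD // subrr theta0. Qed.
Let mG0 : measurable G0. Proof. exact: measurable_two_sided. Qed.
Let G01 : P G0 = 1%E. Proof. exact: (prob_two_sided clam lam_gt0 PP). Qed.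

Let theta_inv E u : <<s cylinders >> E -> shift_invariant E ->
  measurable (G0 `&` [set w | E (thetaO lam u (om w))]) /\
  P (G0 `&` [set w | E (thetaO lam u (om w))]) = P (om @^-1` E).
Proof. exact: theta_invariance. Qed.

(** If the past sums are bounded, service times far in the past fall below any e > 0. Thus bounded
    sums together with a current service of at least [e] cannot recur under backward shifts, and
    stationarity makes this event null; positivity of the current service then allows e to run
    through 1/(m+1). *)
Lemma prob_work_unbounded : measurable
    [set w | forall M : nat, exists k : nat, cumE (path_of H w) (- k%:Z) < - M%:R] /\
  P [set w | forall M : nat, exists k : nat, cumE (path_of H w) (- k%:Z) < - M%:R] = 1%E.
Proof.
pose SQ := g_sigma_algebraType [set A : set (int -> R) |
  exists (i : int) (B : set R), measurable B /\ A = [set s | B (s i)]].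
have mcoord i : measurable_fun setT (fun s : SQ => s i).
  by move=> _ B mB; rewrite setTI; apply: sub_sigma_algebra; exists i, B.
pose bdd (s : int -> R) := exists M : nat, forall k : nat, - M%:R <= cumE s (- k%:Z).
have mge (f : SQ -> R) c : measurable_fun setT f -> measurable [set s | c <= f s].
  move=> mf; rewrite (_ : [set s | c <= f s] = [set s | - f s <= - c]).
    by apply: measurable_le_cst; exact: measurableT_comp.
  by apply/seteqP; split => s /=; rewrite lerN2.
pose B e : set (int -> R) := [set s | bdd s /\ e <= s 0].
have sB e : seq_sigma (B e).
  apply: (@measurableI _ SQ [set s | bdd s] [set s | e <= s 0]); last exact: (mge (fun s => s 0)).
  apply: (@measurable_ex _ SQ) => M; apply: (@measurable_all _ SQ) => k.
  apply: (mge (fun s => cumE s (- k%:Z))).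
  exact: (measurable_cumE (X := fun s : SQ => s) _ mcoord).
have mpath e : measurable (path_of H @^-1` (B e)) by exact: measurable_path.
have B0 (e : R) : 0 < e -> P (path_of H @^-1` (B e)) = 0%E.
  move=> e0.
  apply: (null_recurrence (F := fun n : nat => path_of H @^-1` (shift_seq (- n%:Z) @^-1` B e))
    (G := setT)) => //.
  - by move=> n; apply: measurable_path => //; exact: seq_sigma_shift.
  - by move=> n; apply: stationary_shift.
  - exact: probability_setT.
  move=> w _; set s := path_of H w.
  have s0 i : 0 < s i by exact: H_gt0.
  pose u (n : nat) := cumE s (- n%:Z).
  have uS n : u n = u n.+1 + s (- n.+1%:Z).
    by rewrite /u -cumES; congr (cumE _ _); lia.
  have umono m n : (m <= n)%N -> u n <= u m.
    by move=> mn; apply: cumE_le => //; lia.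
  have [[M hM]|nbdd] := pselect (bdd s); last first.
    exists 0%N => n _ [[M hM] _]; apply: nbdd.
    exists (Num.truncn (M%:R - u n)).+1 => k; rewrite lerNl.
    suff : u n - M%:R <= u k.
      move=> h; apply: (le_trans _ (ltW (truncnS_gt _))).
      by move: h; rewrite -/(u k); lra.
    have [nk|kn] := leqP n k; last first.
      by apply: (le_trans _ (umono _ _ (ltnW kn))); rewrite gerBl.
    have := hM (k - n)%N; rewrite cumE_shift (_ : - (k - n)%N%:Z - n%:Z = - k%:Z); last by lia.
    by rewrite -/(u n) -/(u k); lra.
  have hinf : has_inf (range u).
    by split; [exists (u 0%N), 0%N|exists (- M%:R) => _ [n _ <-]; exact: hM].
  (* Once the decreasing sums are within [e] of their infimum, no further term can reach [e]. *)
  have [_ [N _ <-] hN] := inf_adherent e0 hinf.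
  exists N.+1 => -[//|n] Nn [_]; rewrite /shift_seq sub0r => es.
  have h1 := umono _ _ (Nn : (N <= n)%N).
  have h2 : inf (range u) <= u n.+1 by apply: ge_inf; [case: hinf|exists n.+1].
  have {}es : e <= s (- n.+1%:Z) := es.
  by move: hN; have := uS n; lra.
have E1 : P [set w | forall m : nat, (~` (path_of H @^-1` B m.+1%:R^-1)) w] = 1%E.
  apply: prob_full_forall => m; first exact: measurableC.
  by rewrite probability_setC // B0 ?invr_gt0 // sube0.
set W := [set w | forall M, _].
have mW : measurable W.
  apply: measurable_all => M; apply: measurable_ex => k.
  apply: (_ : measurable [set w | cumE (path_of H w) (- k%:Z) < - M%:R]).
  have -> : [set w | cumE (path_of H w) (- k%:Z) < - M%:R] =
      [set w | M%:R < - cumE (path_of H w) (- k%:Z)].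
    by apply/seteqP; split => w /=; rewrite ltrNr.
  apply: measurable_gt_cst; apply: measurableT_comp => //.
  exact: (measurable_cumE (X := path_of H)).
split => //; apply/eqP; rewrite eq_le probability_le1 //= -E1.
apply: le_measure; rewrite ?inE //; first by apply: measurable_all => m; exact: measurableC.
move=> w h M; apply: contrapT => hk.
have bw : bdd (path_of H w).
  by exists M => k; rewrite leNgt; apply/negP => ?; apply: hk; exists k.
have := H_gt0 0 w; rewrite -invr_gt0 => iH.
apply: (h (Num.truncn (H 0 w)^-1)); split => //.
rewrite -[leRHS]invrK lef_pV2 ?posrE ?ltr0n //; exact/ltW/truncnS_gt.
Qed.

(** For large [n] the point of label [-k0] has been shifted past [x], so the rank [k] at [x] is at
    most [-k0]. A path end is then a gap, negative far in the past, plus an accumulated service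
    below [-c]. *)
Lemma late_work_null x c : P (om @^-1` late_work x c) = 0%E.
Proof.
have [mW W1] := prob_work_unbounded.
have minv n := theta_inv n (measurable_late_work x c) (@late_work_invariant _ x c).
apply: (null_recurrence (P := P)
  (F := fun n : nat => G0 `&` [set w | late_work x c (thetaO lam n%:R (om w))])
  (G := A0 `&` [set w | forall M : nat, exists k : nat, cumE (path_of H w) (- k%:Z) < - M%:R])).
- by move=> n; exact: (minv _).1.
- by move=> n; exact: (minv _).2.
- exact: measurableI.
- by rewrite probI_full.
move=> w [/A0_bar wbar hW]; have [k0 hk0] := hW (Num.truncn c).+1.
exists (Num.truncn (oint lam 0 x - oint lam 0 (Z (- k0%:Z) w))).+1 => n Nn [w0 [k [hk h]]].
(* Membership at time [-n] says that the configuration shifted by [n] itself satisfies the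
   no-overload inequalities from [K] on. *)
have [w' [K hK] w'E] := wbar (- n%:R) I.
have w'E' : thetaO lam n%:R (om w) = w'.
  by rewrite -w'E; case: w' {hK w'E} => z e; congr (_, _); apply/funext => i; rewrite /= thK.
have xz : x < th n%:R (Z (- k0%:Z) w).
  rewrite -(Lam_lt clam lam_gt0) Lam_theta // -ltrBlDl.
  by apply: (lt_le_trans (truncnS_gt _)); rewrite ler_nat.
have kk0 : k <= - k0%:Z.
  have : k - 1 < - k0%:Z; last by lia.
  rewrite -(z_lt (Zstep w)) -(th_lt n%:R).
  by apply: le_lt_trans xz; case: hk.
have [i [im]] := h (maxn K 1).
have {h} gi : gap w'.1 w'.2 i < 0.
  have -> : i = - `|i|%N%:Z by lia.
  rewrite /gap cumEN opprK addrC; apply: hK; lia.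
rewrite /path_end w'E' => ci.
have e : w'.2 = path_of H w by rewrite -w'E'.
have : cumE w'.2 k <= cumE (path_of H w) (- k0%:Z) by rewrite e; apply: cumE_le => // j; exact: H_gt0.
by have := truncnS_gt c; move: hk0 ci gi; lra.
Qed.

Variable x : R.

Definition good u : set T :=
  [set w | two_sided (zz w) /\ forall c : nat, ~ late_work x c%:R (thetaO lam u (om w))].

Lemma prob_good u : measurable (good u) /\ P (good u) = 1%E.
Proof.
pose F (c : nat) := ~` (G0 `&` [set w | late_work x c%:R (thetaO lam u (om w))]).
have minv (c : nat) := theta_inv u (measurable_late_work x c%:R)
  (@late_work_invariant _ x c%:R).
have mF c : measurable (F c) by apply: measurableC; exact: (minv c).1.
have F1 c : P (F c) = 1%E.
  by rewrite probability_setC ?(minv c).2 ?late_work_null ?sube0 //; exact: (minv c).1.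
have -> : good u = G0 `&` [set w | forall c, F c w].
  apply/seteqP; split => w [w0 h]; split => // c; first by move=> [_ /h].
  by move=> hc; apply: (h c).
have mall : measurable [set w | forall c, F c w] by exact: measurable_all.
by split; [exact: measurableI|rewrite probI_full // prob_full_forall].
Qed.

Section GoodPoint.
Variables (u : R) (w : T).
Hypothesis gw : good u w.
Local Notation wu := (thetaO lam u (om w)).

Lemma good_eta i : 0 < wu.2 i. Proof. exact: H_gt0. Qed.

Lemma good_step i : wu.1 i < wu.1 (i + 1).
Proof. by rewrite /= th_lt; exact: Zstep. Qed.

Lemma good_two_sided : two_sided wu.1.
Proof.
case: gw => -[h1 h2] _; split => c.
  by have [i hi] := h1 (th (- u) c); exists i; rewrite -[c](thK u) /= th_lt.
by have [i hi] := h2 (th (- u) c); exists i; rewrite -[c](thK u) /= th_le.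
Qed.

Lemma good_left_regen : left_regen wu.1 wu.2.
Proof. exact: gap_left_regen good_step good_two_sided gw.2. Qed.

End GoodPoint.

Definition exit_rank u w : int :=
  xget 0 [set D : int | forall j, (exit_time (thetaO lam u (om w)) j < x) = (j < D)].

Lemma exit_rankE u w : good u w ->
  forall j, (exit_time (thetaO lam u (om w)) j < x) = (j < exit_rank u w).
Proof.
move=> gw; rewrite /exit_rank.
have [D hD] := exit_rank_exists (good_eta u w) (good_step u w) (good_two_sided gw) gw.2.
by case: xgetP => [D' -> //|/(_ D)].
Qed.

Lemma exit_time_lt_time s t w : s < t -> good s w -> good t w ->
  forall j, exit_time (thetaO lam s (om w)) j < exit_time (thetaO lam t (om w)) j.
Proof.
move=> st gs gt j.
have [_ [i ij <-]] := exit_time_spec (good_eta s w) (good_left_regen gs) j.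
have [h _] := exit_time_spec (good_eta t w) (good_left_regen gt) j.
by apply: lt_le_trans (h i ij); rewrite /gap /= ltrD2r ltrD2r theta_lt_time.
Qed.

Lemma exit_rank_le_time s t w : s < t -> good s w -> good t w ->
  exit_rank t w <= exit_rank s w.
Proof.
move=> st gs gt; have : exit_rank t w - 1 < exit_rank s w; last by lia.
rewrite -(exit_rankE gs) (lt_trans (exit_time_lt_time st gs gt _)) // (exit_rankE gt).
by lia.
Qed.

Lemma good0E w : thetaO lam 0 (om w) = om w.
Proof. by congr (_, _); apply/funext => i; rewrite /= theta0. Qed.

(** * Mean displacement of the exit rank, on an arbitrary almost sure set of good points *)

Section MeanDisplacement.
Variables (t : R) (D : set T).
Hypotheses (t_gt0 : 0 < t) (mD : measurable D) (D1 : P D = 1%E).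
Hypothesis D_good : D `<=` good 0 `&` good t.

Let C k := count_event Z (th (- t) x) x k.

Let th_x : th (- t) x < x.
Proof. by rewrite -[ltRHS](theta0 clam lam_gt0 lam_left lam_right) theta_lt_time // oppr_lt0. Qed.

Let mC k : measurable (C k).
Proof. by apply: (measurable_count_event PP); exact: ltW. Qed.

(** The number of points in the interval from [th (- t) x] to [x], which [theta] carries past [x].
    Written as a series over the count events, its mean is a Poisson mean. *)
Definition arrivals w : \bar R := (\sum_(0 <= k <oo) (k%:R * \1_(C k) w)%:E)%E.

Let queue u m : set T := G0 `&` [set w | queue_ge x m (thetaO lam u (om w))].

Let mqueue u m : measurable (queue u m).
Proof. by have [] := theta_inv u (measurable_queue_ge x m) (@queue_ge_invariant _ x m). Qed.

Let queue_law m : P (queue t m) = P (queue 0 m).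
Proof.
have [_ ->] := theta_inv t (measurable_queue_ge x m) (@queue_ge_invariant _ x m).
by have [_ ->] := theta_inv 0 (measurable_queue_ge x m) (@queue_ge_invariant _ x m).
Qed.

Definition displacement w : \bar R := ((exit_rank 0 w - exit_rank t w)%:~R : R)%:E.

(** From D_0 - D_t = (A_0 - A_t) + Q_t - Q_0 with both queues Q cut off at [n]: the sum of the
    indicators of Q >= m for m from 1 to [n] is min(Q, n). *)
Let truncated n w : \bar R :=
  (arrivals w + (\sum_(1 <= m < n.+1) (\1_(queue t m) w - \1_(queue 0 m) w))%:E)%E.

Let term_meas k : measurable_fun setT (EFin \o (fun w => k%:R * \1_(C k) w : R)).
Proof. by apply/measurable_EFinP; apply: measurable_funM. Qed.

Let arrivals_meas : measurable_fun setT arrivals.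
Proof.
apply: (ge0_emeasurable_sum (P := xpredT) (h := fun k w => (k%:R * \1_(C k) w)%:E)) => k.
  by move=> w _ _; rewrite lee_fin mulr_ge0.
by move=> _; exact: term_meas.
Qed.

Let indic_integrable A : measurable A -> P.-integrable D (fun w => (\1_A w)%:E).
Proof. by move=> mA; apply: (integrableS measurableT) => //; exact: integrable_indic. Qed.

Let arrivals_ge0 w : (0 <= arrivals w)%E.
Proof. by apply: nneseries_ge0 => k _ _; rewrite lee_fin mulr_ge0. Qed.

Let arrivals_mean : (\int[P]_(w in D) arrivals w = t%:E)%E.
Proof.
have mean_x : oint lam (th (- t) x) x = t.
  rewrite (ointE clam) Lam_theta //; ring.
rewrite integral_nneseries //.
- transitivity (\sum_(0 <= k <oo) (k%:R * poisson_pmf t k)%:E)%E; last exact: poisson_pmf_mean.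
  apply: eq_eseriesr => k _; under eq_integral do rewrite EFinM.
  rewrite integralZl //; last exact: indic_integrable.
  rewrite integral_indic // EFinM; congr (_ * _)%E.
  rewrite -mean_x -(prob_count_event PP) // setIC; exact: probI_full.
- by move=> k; apply: measurable_funTS; exact: term_meas.
Qed.

Let arrivals_count w k : C k w -> arrivals w = k%:R%:E.
Proof.
move=> Ck; have other j : j != k -> \1_(C j) w = 0 :> R.
  move=> jk; rewrite indicE memNset // => Cj; move/eqP: jk; apply.
  by apply/card_eq_II; rewrite (card_eq_trans _ Ck) // card_eq_sym.
rewrite /arrivals (nneseries_split _ k.+1); last by move=> j _; rewrite lee_fin mulr_ge0.
rewrite add0n big_nat_recr //= big1_seq ?add0e; last first.
  move=> j; rewrite mem_index_iota => /andP[_ jk].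
  by rewrite other ?mulr0 // ltn_eqF.
rewrite indicE mem_set // mulr1 eseries0 ?adde0 // => j kj _.
by rewrite other ?mulr0 // gtn_eqF.
Qed.

Let pointwise w : D w -> exists B At : int,
  [/\ arrivals w = ((B - At)%:~R : R)%:E,
      [/\ exit_rank 0 w <= B, exit_rank t w <= At, exit_rank t w <= exit_rank 0 w & At <= B],
      (forall m, (\1_(queue 0 m) w : R) = (exit_rank 0 w + m%:Z <= B)%R%:R) &
      (forall m, (\1_(queue t m) w : R) = (exit_rank t w + m%:Z <= At)%R%:R)].
Proof.
move=> /D_good[g0 gt].
have hq u A : good u w -> at_rank x A (thetaO lam u (om w)).1 ->
    exit_rank u w <= A /\
    forall m, (\1_(queue u m) w : R) = (exit_rank u w + m%:Z <= A)%R%:R.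
  move=> gu hA; have s := good_step u w; have e := good_eta u w.
  have ts := good_two_sided gu; have D_ := exit_rankE gu.
  split; first exact: (exit_rank_le e s ts gu.2 hA D_).
  move=> m; rewrite indicE; congr (nat_of_bool _)%:R.
  apply/idP/idP; first by rewrite inE => -[_ /(queue_geE e s ts gu.2 hA D_)].
  move=> h; rewrite inE; split; first exact: gu.1.
  exact/(queue_geE e s ts gu.2 hA D_).
have [A hA] := at_rank_exists (good_step 0 w) x (good_two_sided g0).
have [At hAt] := at_rank_exists (good_step t w) x (good_two_sided gt).
have [D0 q0] := hq _ _ g0 hA; have [Dt qt] := hq _ _ gt hAt.
have hA' : at_rank x A (zz w) by move: hA; rewrite good0E.
have hAt' : at_rank (th (- t) x) At (zz w).
  by case: hAt => h1 h2; split; [rewrite -(th_le t) thK|rewrite -(th_lt t) thK].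
have AtA := at_rank_mono (Zstep w) (ltW th_x) hAt' hA'.
exists A, At; split => //; last by split => //; exact: exit_rank_le_time.
have -> : (A - At)%:~R = `|A - At|%N%:R :> R.
  by rewrite pmulrn; congr (_%:~R); lia.
apply: arrivals_count; apply: (count_at (Zstep w) hAt').
by rewrite (_ : At + _ = A) //; lia.
Qed.

Let sum_queue (q : int) n : 0 <= q ->
  \sum_(1 <= m < n.+1) ((m%:Z <= q)%R%:R : R) = (Num.min q n%:Z)%:~R.
Proof.
move=> q0; elim: n => [|n ih]; first by rewrite big_geq // min_r.
rewrite big_nat_recr //= ih.
have [nq|qn] := leP n.+1%:Z q.
  by rewrite min_r ?min_r; [rewrite -addn1 PoszD intrD|lia..].
by rewrite addr0 !min_l //; lia.
Qed.

Let truncatedE w : D w -> exists B Bt : int,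
  [/\ arrivals w = ((B - Bt)%:~R : R)%:E,
    0 <= B - exit_rank 0 w, 0 <= Bt - exit_rank t w, exit_rank t w <= exit_rank 0 w &
    forall n, truncated n w = ((B - Bt + Num.min (Bt - exit_rank t w) n%:Z -
                      Num.min (B - exit_rank 0 w) n%:Z)%:~R : R)%:E].
Proof.
move=> /pointwise[B [Bt [arr [h1 h2 h3 h4] q0 qt]]]; exists B, Bt.
split; rewrite ?subr_ge0 // => n; rewrite /truncated arr -EFinD; congr (_%:E).
rewrite sumrB !intrB !intrD -!sum_queue ?subr_ge0 //.
have -> : \sum_(1 <= m < n.+1) \1_(queue t m) w =
    \sum_(1 <= m < n.+1) ((m%:Z <= Bt - exit_rank t w)%R%:R : R).
  by apply: eq_bigr => m _; rewrite qt; congr (nat_of_bool _)%:R; lia.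
have -> : \sum_(1 <= m < n.+1) \1_(queue 0 m) w =
    \sum_(1 <= m < n.+1) ((m%:Z <= B - exit_rank 0 w)%R%:R : R).
  by apply: eq_bigr => m _; rewrite q0; congr (nat_of_bool _)%:R; lia.
by ring.
Qed.

Let arrivals_integrable : P.-integrable D arrivals.
Proof.
apply/integrableP; split; first by apply: measurable_funTS; exact: arrivals_meas.
under eq_integral do rewrite gee0_abs //.
by rewrite arrivals_mean ltry.
Qed.

(** Each new pair of indicators is bounded and has mean difference zero, because the queue has the
    same law at both times. *)
Let truncated_mean n : P.-integrable D (truncated n) /\
  (\int[P]_(w in D) truncated n w = t%:E)%E.
Proof.
have iq u m : P.-integrable D (fun w => (\1_(queue u m) w)%:E) by exact: indic_integrable.
elim: n => [|n [ih1 ih2]].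
  have -> : truncated 0 = arrivals.
    by apply/funext => w; rewrite /truncated big_geq // adde0.
  by split; [exact: arrivals_integrable|exact: arrivals_mean].
have -> : truncated n.+1 = (truncated n \+
    ((fun w => (\1_(queue t n.+1) w)%:E) \- (fun w => (\1_(queue 0 n.+1) w)%:E)))%E.
  by apply/funext => w; rewrite /truncated big_nat_recr //= EFinD addeA EFinB.
have iB := integrableB mD (iq t n.+1) (iq 0 n.+1).
split; first exact: integrableD.
have mean_queue u m : (\int[P]_(w in D) (\1_(queue u m) w)%:E = P (queue u m))%E.
  by rewrite integral_indic // setIC; exact: probI_full.
rewrite integralD // ih2 integralB // !mean_queue queue_law subee ?adde0 //.
exact: fin_num_measure.
Qed.

Let truncated_cvg w : D w -> truncated n w @[n --> \oo] --> displacement w.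
Proof.
move=> /truncatedE[B [Bt [arr h1 h2 _ h]]]; apply: cvg_near_cst.
exists (`|B - exit_rank 0 w| + `|Bt - exit_rank t w|)%N => // n /= nN.
rewrite h /displacement; congr (_%:~R%:E).
by rewrite !min_l; lia.
Qed.

Let displacement_ge0 w : D w -> (0 <= displacement w)%E.
Proof. by move=> /truncatedE[B [Bt [_ _ _ h _]]]; rewrite lee_fin ler0z subr_ge0. Qed.

(** The difference of the cut-off queues lies between 0 and Q_t - Q_0, so [truncated] lies between
    [arrivals] and [displacement], both nonnegative. *)
Let truncated_bounds w n : D w -> (0 <= truncated n w <= arrivals w + displacement w)%E.
Proof.
move=> /truncatedE[B [Bt [arr h1 h2 h3 ->]]]; have := arrivals_ge0 w.
rewrite arr /displacement -EFinD !lee_fin -intrD !ler0z ler_int => h4.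
by case: (leP (Bt - exit_rank t w) n%:Z); case: (leP (B - exit_rank 0 w) n%:Z); lia.
Qed.

Lemma mean_displacement : [/\ measurable_fun D displacement,
  forall w, D w -> (0 <= displacement w)%E & (\int[P]_(w in D) displacement w = t%:E)%E].
Proof.
have mT n : measurable_fun D (truncated n).
  by have [/integrableP[]] := truncated_mean n.
have mS : measurable_fun D displacement by exact: emeasurable_fun_cvg mT truncated_cvg.
(* Fatou's lemma must come first: it makes [displacement] integrable, and only then is [arrivals]
   plus [displacement] an integrable dominating function. *)
have S_le : (\int[P]_(w in D) displacement w <= t%:E)%E.
  rewrite (eq_integral (fun w => limn_einf (truncated^~ w))); last first.
    by move=> w; rewrite inE => /truncated_cvg/cvg_limn_einf_sup[-> _].
  apply: le_trans (fatou P mD mT _) _.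
    by move=> n w /(truncated_bounds n)/andP[].
  rewrite (_ : (fun n => _) = cst t%:E); last first.
    by apply/funext => n; have [_ ->] := truncated_mean n.
  by have [-> _] := cvg_limn_einf_sup (cvg_cst (t%:E : \bar R)).
have iS : P.-integrable D displacement.
  apply/integrableP; split => //.
  rewrite (eq_integral displacement); first by rewrite (le_lt_trans S_le) ?ltry.
  by move=> w; rewrite inE => /displacement_ge0 h; rewrite gee0_abs.
split=> //.
have fin w : D w -> (arrivals \+ displacement)%E w \is a fin_num.
  by move=> /truncatedE[B [Bt [arr _ _ _ _]]]; rewrite /= arr.
have dom n w : D w -> (`|truncated n w| <= (arrivals \+ displacement) w)%E.
  by move=> /(truncated_bounds n)/andP[? ?]; rewrite gee0_abs.
have := dominated_cvg mD mT truncated_cvg fin (integrableD mD arrivals_integrable iS) dom.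
have -> : (fun n => \int[P]_(w in D) truncated n w)%E = cst t%:E.
  by apply/funext => n; have [_ ->] := truncated_mean n.
by move=> /cvg_lim <- //; rewrite lim_cst.
Qed.

End MeanDisplacement.

Lemma exit_at_null : P (om @^-1` exit_at x) = 0%E.
Proof.
have le_t t : 0 < t -> (P (om @^-1` exit_at x) <= t%:E)%E.
  move=> t0; have [mg0 g01] := prob_good 0; have [mgt gt1] := prob_good t.
  have mD : measurable (good 0 `&` good t) by exact: measurableI.
  have D1 : P (good 0 `&` good t) = 1%E by rewrite probI_full.
  have [mf f0 <-] := mean_displacement t0 mD D1 (@subset_refl _ _).
  have [mF <-] := theta_inv t (measurable_exit_at x) (@exit_at_invariant _ x).
  set F := G0 `&` _ in mF *.
  rewrite -(probI_full mD D1 mF) setIC -integral_indic //.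
  apply: ge0_le_integral => //.
  - by apply/measurable_EFinP; exact: measurable_indic.
  move=> w [gw0 gwt]; rewrite indicE; case: (boolP (w \in F)) => [|_]; last exact: f0.
  rewrite inE => -[w0].
  move=> /(exit_atE (good_eta t w) (good_step t w) (good_two_sided gwt) gwt.2)[j yj].
  rewrite /displacement lee_fin ler1z.
  (* Before the shift, customer [j] exits strictly before [x] and is counted; after it he exits at
     [x] and is not, so the rank drops by at least one. *)
  have : j < exit_rank 0 w.
    by rewrite -(exit_rankE gw0) -yj exit_time_lt_time.
  have : (j < exit_rank t w) = false by rewrite -(exit_rankE gwt) yj ltxx.
  by lia.
have pfin : P (om @^-1` exit_at x) \is a fin_num.
  apply: fin_num_measure; apply: (omega_of_measurable clam lam_gt0 lam_left lam_right PP statH indepZH).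
  exact: measurable_exit_at.
apply/eqP; rewrite eq_le measure_ge0 andbT; apply/lee_addgt0Pr => e e0.
by rewrite add0e; exact: le_t.
Qed.

Lemma mean_Sfrak : (\int[P]_w Sfrak lam (om w) x = 1)%E.
Proof.
have [mg0 g01] := prob_good 0; have [mgt gt1] := prob_good 1.
have [mF] := theta_inv 1 (measurable_exit_at x) (@exit_at_invariant _ x).
rewrite exit_at_null; set F := G0 `&` _ in mF * => F0.
have mD1 : measurable (good 0 `&` good 1) by exact: measurableI.
have D11 : P (good 0 `&` good 1) = 1%E by rewrite probI_full.
have mD : measurable ((good 0 `&` good 1) `&` ~` F) by apply: measurableI => //; exact: measurableC.
have D1 : P ((good 0 `&` good 1) `&` ~` F) = 1%E.
  by rewrite probI_full ?probability_setC ?F0 ?sube0 //; exact: measurableC.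
have [_ _ <-] := mean_displacement ltr01 mD D1 (@subIsetl _ _ _).
rewrite (integral_full mD D1); last by move=> w; exact: esum_ge0.
apply: eq_integral => w; rewrite inE => -[[gw0 gw1] nF].
have h : exit_rank 1 w <= exit_rank 0 w by exact: exit_rank_le_time.
rewrite /displacement -(esum_int_range h) /Sfrak; congr (esum _ _).
apply/seteqP; split => i /=; rewrite -(exit_rankE gw0) good0E.
  move=> [-> y1]; rewrite andbT leNgt -(exit_rankE gw1) -leNgt ltW //.
rewrite leNgt -(exit_rankE gw1) -leNgt => /andP[y1 y0]; split; first by [].
(* The ranks give only a weak inequality for the shifted exit; equality is the null event [F], which
   was removed from the domain. *)
rewrite lt_neqAle y1 andbT; apply/eqP => e; apply: nF; split; first exact: gw0.1.
apply/(exit_atE (good_eta 1 w) (good_step 1 w) (good_two_sided gw1) gw1.2).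
by exists i.
Qed.

End Queue.

Theorem theorem2 (R : realType) (d : measure_display) (T : measurableType d)
  (P : probability T R) (lam : R -> R) (Z H : int -> T -> R) :
  continuous lam ->
  (forall y, 0 < lam y) ->
  (\int[lebesgue_measure]_(u in `]-oo, 0%R]) (lam u)%:E = +oo)%E ->
  (\int[lebesgue_measure]_(u in `[0%R, +oo[) (lam u)%:E = +oo)%E ->
  poisson_process P lam Z ->
  stationary P H -> ergodic P H ->
  (forall i w, 0 < H i w) ->
  indep_processes P Z H ->
  (* no-overload condition S(bar Omega) = 1 *)
  (exists A : set T, measurable A /\ P A = 1%E /\
     A `<=` omega_of Z H @^-1` Omega_bar lam) ->
  forall x : R, (\int[P]_w Sfrak lam (omega_of Z H w) x = 1)%E.
Proof.
move=> clam lam_gt0 lam_left lam_right PP statH _ H_gt0 indepZH [A [mA [A1 Abar]]] x.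
exact: (mean_Sfrak clam lam_gt0 lam_left lam_right PP statH H_gt0 indepZH mA A1 Abar).
Qed.
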